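(* Assume that all right-hand sides of assignments in an arbitrary program contain occurrences of at most one program variable. Then all inter-procedurally valid Herbrand equalities can be inferred, i.e., for every program point $v$ the set of all equalities $s\doteq t$ between terms over $\Omega$ and the program variables that are valid whenever $v$ is reached can be effectively determined.
   Context: $\Omega$ is a ranked signature with non-empty set of constants; values are ground terms over $\Omega$. A program consists of a finite set of parameterless procedures (including a main procedure) operating on a finite set $\mathbf{X}$ of global program variables; each procedure is a control flow graph with start and return points whose edges are labelled by assignments $\mathbf{x}=t$ with $t$ a term over $\Omega$ and $\mathbf{X}$, non-deterministic assignments $\mathbf{x}=?$ (assigning an arbitrary ground term), or procedure calls $q()$. States map program variables to ground terms; executions follow inter-procedurally valid paths (calls matched with returns) from the start point of main. An equality is valid at $v$ if it holds in every state with which $v$ can be reached. *)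

(* Defs.v *)
From Stdlib Require List.
From mathcomp Require Import all_boot.

Set Implicit Arguments.
Unset Strict Implicit.
Unset Printing Implicit Defensive.

(** * Terms over a ranked signature *)

Section Terms.

Variables (Omega : Type) (ar : Omega -> nat).

(* Raw terms; ranks are enforced by [wf_term]. *)
Inductive term : Type :=
  | Var of nat
  | App of Omega & seq term.

(* Terms over the signature and the variables {0, ..., n-1}. *)
Fixpoint wf_term (n : nat) (t : term) : bool :=
  match t with
  | Var x => x < n
  | App f ts => (size ts == ar f) && all (wf_term n) ts
  end.

Definition ground (t : term) : bool := wf_term 0 t.

Fixpoint occurrences (t : term) : seq nat :=
  match t with
  | Var x => [:: x]
  | App _ ts => flatten (map occurrences ts)
  end.

(* The single variable may occur several times, as in f(x, x). *)
Definition at_most_one_var (t : term) : bool :=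
  size (undup (occurrences t)) <= 1.

(* Only the values at the program variables {0, ..., n-1} matter. *)
Definition state : Type := nat -> term.

Definition is_state (n : nat) (sigma : state) : Prop :=
  forall x, x < n -> ground (sigma x).

Fixpoint subst (sigma : state) (t : term) : term :=
  match t with
  | Var x => sigma x
  | App f ts => App f (map (subst sigma) ts)
  end.

Definition update (sigma : state) (x : nat) (t : term) : state :=
  fun y => if y == x then t else sigma y.

Definition equality : Type := (term * term)%type.

Definition wf_equality (n : nat) (e : equality) : bool :=
  wf_term n e.1 && wf_term n e.2.

Definition holds (sigma : state) (e : equality) : Prop :=
  subst sigma e.1 = subst sigma e.2.

Definition entails (n : nat) (E : seq equality) (e : equality) : Prop :=
  forall sigma, is_state n sigma ->
    (forall e', List.In e' E -> holds sigma e') -> holds sigma e.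

(** * Programs *)

Inductive label : Type :=
  | Assign of nat & term
  | Havoc of nat              (* x = ? *)
  | Call of nat.

Record procedure : Type := Procedure {
  npoints : nat;
  start : nat;
  return_ : nat;
  edges : seq (nat * label * nat)
}.

(* The program variables are {0, ..., nvars-1}; procedures are named by their
   index in [procs]. *)
Record program : Type := Program {
  nvars : nat;
  main : nat;
  procs : seq procedure
}.

(* A program point is a procedure name together with one of its nodes. *)
Definition point : Type := (nat * nat)%type.

Definition is_point (p : program) (v : point) : Prop :=
  exists2 P, onth (procs p) v.1 = Some P & v.2 < npoints P.

Definition wf_label (n k : nat) (l : label) : bool :=
  match l with
  | Assign x t => (x < n) && wf_term n t
  | Havoc x => x < n
  | Call q => q < k
  end.

Definition wf_procedure (n k : nat) (P : procedure) : bool :=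
  [&& start P < npoints P, return_ P < npoints P &
      all (fun e => [&& e.1.1 < npoints P, wf_label n k e.1.2
                      & e.2 < npoints P]) (edges P)].

Definition wf_program (p : program) : bool :=
  (main p < size (procs p)) &&
  all (wf_procedure (nvars p) (size (procs p))) (procs p).

Definition rhs_at_most_one_var (p : program) : bool :=
  all (fun P => all (fun e => if e.1.2 is Assign _ t then at_most_one_var t
                              else true) (edges P)) (procs p).

Definition is_start (p : program) (v : point) : Prop :=
  exists2 P, onth (procs p) v.1 = Some P & v.2 = start P.

Definition is_return (p : program) (v : point) : Prop :=
  exists2 P, onth (procs p) v.1 = Some P & v.2 = return_ P.

Definition has_edge (p : program) (u : point) (l : label) (v : point) : Prop :=
  u.1 = v.1 /\
  exists2 P, onth (procs p) u.1 = Some P & List.In (u.2, l, v.2) (edges P).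

(* [exec p v stk sigma]: some execution of [p] along an inter-procedurally valid
   path leads to the point [v] with state [sigma]; [stk] lists the points at
   which the pending calls are to be resumed, innermost first.  The variables
   are global and uninitialised, so that the initial state is arbitrary. *)
Inductive exec (p : program) : point -> seq point -> state -> Prop :=
  | exec_init v sigma :
      v.1 = main p -> is_start p v -> is_state (nvars p) sigma ->
      exec p v [::] sigma
  | exec_assign u v stk sigma x t :
      exec p u stk sigma -> has_edge p u (Assign x t) v ->
      exec p v stk (update sigma x (subst sigma t))
  | exec_havoc u v stk sigma x g :
      exec p u stk sigma -> has_edge p u (Havoc x) v -> ground g ->
      exec p v stk (update sigma x g)
  | exec_call u v w stk sigma q :
      exec p u stk sigma -> has_edge p u (Call q) v ->
      w.1 = q -> is_start p w ->
      exec p w (v :: stk) sigma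
  | exec_return w v stk sigma :
      exec p w (v :: stk) sigma -> is_return p w ->
      exec p v stk sigma.

Definition valid (p : program) (v : point) (e : equality) : Prop :=
  forall stk sigma, exec p v stk sigma -> holds sigma e.

End Terms.

(** * Effective computability *)

(* The model of computation is first-order general recursion over binary trees
   (pure LISP without symbols): a [code] is a finite list of unary, mutually
   recursive function definitions, the first of which is the one computed. *)

Inductive tree : Type :=
  | Leaf
  | Node of tree & tree.

Inductive expr : Type :=
  | Arg
  | ELeaf
  | ENode of expr & expr
  | ELeft of expr
  | ERight of expr
  | EIf of expr & expr & expr    (* tests for a [Node] *)
  | ECall of nat & expr.

Definition code : Type := seq expr.

Definition left_ (a : tree) : tree := if a is Node l _ then l else Leaf.

Definition right_ (a : tree) : tree := if a is Node _ r then r else Leaf.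

(* Call-by-value evaluation of an expression, [a] being the value of [Arg].
   The relation is functional in its last argument, and partial because
   recursive calls need not terminate. *)
Inductive eval (C : code) (a : tree) : expr -> tree -> Prop :=
  | eval_arg : eval C a Arg a
  | eval_leaf : eval C a ELeaf Leaf
  | eval_node e1 e2 b1 b2 :
      eval C a e1 b1 -> eval C a e2 b2 -> eval C a (ENode e1 e2) (Node b1 b2)
  | eval_left e b : eval C a e b -> eval C a (ELeft e) (left_ b)
  | eval_right e b : eval C a e b -> eval C a (ERight e) (right_ b)
  | eval_if_node e e1 e2 l r b :
      eval C a e (Node l r) -> eval C a e1 b -> eval C a (EIf e e1 e2) b
  | eval_if_leaf e e1 e2 b :
      eval C a e Leaf -> eval C a e2 b -> eval C a (EIf e e1 e2) b
  | eval_call i e body b c :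
      eval C a e b -> onth C i = Some body -> eval C b body c ->
      eval C a (ECall i e) c.

Definition computes (C : code) (a b : tree) : Prop := eval C a (ECall 0 Arg) b.

(** * Encoding of programs and equalities as trees *)

Definition enc_seq (ts : seq tree) : tree := foldr Node Leaf ts.

Definition enc_nat (n : nat) : tree := iter n (Node Leaf) Leaf.

Definition enc_bool (b : bool) : tree := if b then Node Leaf Leaf else Leaf.

Section Encoding.

Variable Omega : countType.

(* Function symbols are represented by their number [pickle f]. *)
Fixpoint enc_term (t : term Omega) : tree :=
  match t with
  | Var x => enc_seq [:: enc_nat 0; enc_nat x]
  | App f ts =>
      enc_seq [:: enc_nat 1; enc_nat (pickle f); enc_seq (map enc_term ts)]
  end.

Definition enc_equality (e : equality Omega) : tree :=
  Node (enc_term e.1) (enc_term e.2).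

Definition enc_equalities (E : seq (equality Omega)) : tree :=
  enc_seq (map enc_equality E).

Definition enc_label (l : label Omega) : tree :=
  match l with
  | Assign x t => enc_seq [:: enc_nat 0; enc_nat x; enc_term t]
  | Havoc x => enc_seq [:: enc_nat 1; enc_nat x]
  | Call q => enc_seq [:: enc_nat 2; enc_nat q]
  end.

Definition enc_edge (e : nat * label Omega * nat) : tree :=
  enc_seq [:: enc_nat e.1.1; enc_label e.1.2; enc_nat e.2].

Definition enc_procedure (P : procedure Omega) : tree :=
  enc_seq [:: enc_nat (npoints P); enc_nat (start P); enc_nat (return_ P);
              enc_seq (map enc_edge (edges P))].

Definition enc_program (p : program Omega) : tree :=
  enc_seq [:: enc_nat (nvars p); enc_nat (main p);
              enc_seq (map enc_procedure (procs p))].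

Definition enc_point (v : point) : tree := Node (enc_nat v.1) (enc_nat v.2).

End Encoding.

(* Main.v *)
(** Execute programs symbolically: initial values are variables, and a havoc
    yields an arbitrary variable.  If there are two distinct ground terms, an
    equality is valid at a point iff it holds syntactically in all symbolic
    states reaching it.

    Number the terms injectively such that prepending an irreducible one-variable
    context [g] is the affine map [t |-> 2 ^ i * (2 t + 1)], where [i] depends on
    [g] only.  Overlapping contexts break this only for the finitely many ground
    subterms of the program, so right-hand sides with at most one variable act
    linearly on a finite-dimensional space spanned by the numbers (and head
    symbols) of subterms at the positions of the given equality, the indicators
    of these ground subterms, and the constant 1.  On this space the equality is
    a conjunction of linear conditions, and all values of a havoc are affine
    combinations of two of them.  Procedure effects thus span matrix spaces, whose
    dimension bounds the length of ascending chains; hence testing all executions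
    up to a computable length decides validity.

    All valid equalities follow from those of the form [x = t] where [t] takes
    the value of [x] in one reachable symbolic state; there are finitely many. *)

From HB Require Import structures.
From Stdlib Require Import ClassicalEpsilon.
Require Import Defs.
From mathcomp Require Import all_boot all_order all_algebra zify ring.

Set Implicit Arguments.
Unset Strict Implicit.
Unset Printing Implicit Defensive.

(** * Terms and one-variable contexts *)

(** The numbering is obtained by classical choice and is not computable. This is harmless: the
    numbering, the matrices and the level at which the spans stabilize live only in the correctness
    proof. The algorithm just runs the program for a number of rounds computed from the size of its
    input, and the algebra contributes only a dimension to that number. Filling is not free:
    [f(x, a)] and [f(a, x)] give the same term on [a]. Away from the ground subterms of the program
    the outermost irreducible factor is unique, so it can be coded by an exponent of 2. A context
    that duplicates its variable, such as [f(x, x)], is one factor like any other, and hence acts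
    affinely as well. Stabilization concerns spans of matrices, not sets of words: the words of a
    fixed derivation height that use two atoms span the effects of all words with all atoms. A
    derivation of height [k] unfolds into fewer than [2 ^ (k + 1)] steps, whence an exponential
    number of rounds. *)

Lemma leq_sumn_nth (s : seq nat) i : nth 0 s i <= sumn s.
Proof.
elim: s i => [|x s IH] [|i] //=; first exact: leq_addr.
by have := IH i; lia.
Qed.

Lemma leq_sumn_mem (s : seq nat) x : x \in s -> x <= sumn s.
Proof. by move=> xs; rewrite -(nth_index 0 xs) leq_sumn_nth. Qed.

Section TermInd.
Variables (Omega : Type) (P : term Omega -> Prop).
Hypothesis Pvar : forall x, P (Var Omega x).
Hypothesis Papp : forall f ts, foldr (fun t => and (P t)) True ts -> P (App f ts).

Fixpoint term_fold_ind (t : term Omega) : P t :=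
  match t with
  | Var x => Pvar x
  | App f ts => Papp f
      ((fix all_ts ts : foldr (fun t => and (P t)) True ts :=
          if ts is t :: ts' then conj (term_fold_ind t) (all_ts ts') else I) ts)
  end.
End TermInd.

Section Countable.
Variable Omega : countType.

(** Terms become a [countType], so that contexts, being terms, have a [pickle] number to serve as
    exponent in the numbering. The node label 0 carries no information. *)
Fixpoint gentree_of_term (t : term Omega) : GenTree.tree (nat + Omega) :=
  match t with
  | Var x => GenTree.Leaf (inl x)
  | App f ts => GenTree.Node 0 (GenTree.Leaf (inr f) :: map gentree_of_term ts)
  end.

Fixpoint term_of_gentree (g : GenTree.tree (nat + Omega)) : option (term Omega) :=
  match g with
  | GenTree.Leaf (inl x) => Some (Var Omega x)
  | GenTree.Node _ (GenTree.Leaf (inr f) :: gs) =>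
      Some (App f (pmap term_of_gentree gs))
  | _ => None
  end.

Lemma gentree_of_termK : pcancel gentree_of_term term_of_gentree.
Proof.
elim/term_fold_ind => [//|f ts IH] /=; congr (Some (App f _)).
by elim: ts IH => //= t ts IHts [-> /IHts /= ->].
Qed.

HB.instance Definition _ := Countable.copy (term Omega) (pcan_type gentree_of_termK).
End Countable.

Section Contexts.
Variable Omega : countType.
Implicit Types (t u r a b c : term Omega) (S : seq (term Omega)).
Notation V := (Var Omega).

Lemma term_in_ind (P : term Omega -> Prop) :
  (forall x, P (V x)) ->
  (forall f ts, (forall t, t \in ts -> P t) -> P (App f ts)) -> forall t, P t.
Proof.
move=> Pv Pa; elim/term_fold_ind => // f ts IH; apply: Pa.
elim: ts IH => //= t ts IHts [Pt /IHts Pts] s; rewrite inE => /orP[/eqP->//|].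
exact: Pts.
Qed.

Fixpoint term_size t : nat := if t is App _ ts then (sumn (map term_size ts)).+1 else 1.

Lemma term_size_gt0 t : 0 < term_size t. Proof. by case: t. Qed.

Lemma term_size_arg f ts t : t \in ts -> term_size t < term_size (App f ts).
Proof. by move=> tin /=; rewrite ltnS; apply/leq_sumn_mem/map_f. Qed.

Lemma subst_eq_in (s1 s2 : state Omega) t :
  {in occurrences t, s1 =1 s2} -> subst s1 t = subst s2 t.
Proof.
elim/term_in_ind: t => [x|f ts IH] /= E; first by apply: E; rewrite inE.
congr App; apply/eq_in_map => t tin; apply: IH => // x xin; apply: E.
by apply/flattenP; exists (occurrences t) => //; apply: map_f.
Qed.

Lemma subst_comp (s1 s2 : state Omega) t :
  subst s1 (subst s2 t) = subst (fun x => subst s1 (s2 x)) t.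
Proof.
elim/term_in_ind: t => [x|f ts IH] //=; congr App.
by rewrite -map_comp; apply/eq_in_map => t /IH.
Qed.

Lemma subst_id t : subst V t = t.
Proof.
elim/term_in_ind: t => [x|f ts IH] //=; congr App.
by rewrite -[RHS]map_id; apply/eq_in_map => t /IH.
Qed.

(* A term is used as a one-variable context by filling all its variables with
   the same term; normalized contexts have [Var 0] as their only variable. *)
Definition fill r u := subst (fun=> u) r.
Definition hole t := occurrences t != [::].
Definition normalized t := fill t (V 0) == t.

Lemma hole_app f ts : hole (App f ts) = has hole ts.
Proof.
by rewrite /hole /=; elim: ts => //= t ts <-; case: (occurrences t).
Qed.

Lemma nohole_subst s t : ~~ hole t -> subst s t = t.
Proof.
rewrite negbK => /eqP E; rewrite -[RHS]subst_id; apply: subst_eq_in.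
by rewrite E.
Qed.

Lemma fill_fill a c u : fill (fill a c) u = fill a (fill c u).
Proof. exact: subst_comp. Qed.

Lemma fill_norm a u : fill (fill a (V 0)) u = fill a u.
Proof. exact: fill_fill. Qed.

Lemma fillV0 t : normalized t -> fill t (V 0) = t. Proof. by move/eqP. Qed.

Lemma normal_fill a c : normalized c -> normalized (fill a c).
Proof. by move=> nc; rewrite /normalized fill_fill fillV0. Qed.

Lemma hole_fill a c : hole (fill a c) = hole a && hole c.
Proof.
elim/term_in_ind: a => [x|f ts IH] //; rewrite [fill _ _]/= !hole_app.
elim: ts IH => //= t ts IHts IH; rewrite IHts => [|s sin]; last first.
  by apply: IH; rewrite inE sin orbT.
by rewrite -/(fill t c) IH ?inE ?eqxx // andb_orl.
Qed.

Lemma normal_app f ts : normalized (App f ts) = all normalized ts.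
Proof.
apply/eqP/allP => [[] E t tin|E /=].
  apply/eqP; move: tin => /(nthP (V 0))[i ilt <-].
  by rewrite -[in RHS]E (nth_map (V 0)).
congr App; rewrite -[RHS]map_id; apply/eq_in_map => t /E /eqP; exact.
Qed.

Lemma fill_inj a u v : hole a -> fill a u = fill a v -> u = v.
Proof.
elim/term_in_ind: a => [x|f ts IH] //; rewrite hole_app => /hasP[t tin ht].
case=> /eq_in_map E; exact: (IH t tin ht (E t tin)).
Qed.

(** Each hole trades a leaf of size 1 for a copy of [u]; the additive form avoids truncated
    subtraction. *)
Lemma term_size_fill a u :
  term_size (fill a u) + size (occurrences a) =
  term_size a + size (occurrences a) * term_size u.
Proof.
elim/term_in_ind: a => [x|f ts IH] /=; first by rewrite mul1n addnC.
elim: ts IH => //= t ts IHts IH; rewrite size_cat.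
have := IH t (mem_head _ _); rewrite /fill.
have := IHts (fun s sin => IH s (@mem_behead _ (t :: ts) s sin)).
rewrite /fill; lia.
Qed.

Lemma hole_size a : hole a -> 0 < size (occurrences a).
Proof. by rewrite /hole; case: (occurrences a). Qed.

Lemma term_size_fill_ge a u : hole a -> term_size a + term_size u <= (term_size (fill a u)).+1.
Proof.
move/hole_size; have := term_size_fill a u; have := term_size_gt0 u; nia.
Qed.

Lemma hole_app_term_size f ts : hole (App f ts) -> 1 < term_size (App f ts).
Proof.
rewrite hole_app => /hasP[t tin _]; have := term_size_arg f tin.
have := term_size_gt0 t; lia.
Qed.

Lemma fill_loop a u : hole a -> fill a u = u -> exists x, a = V x.
Proof.
case: a => [x|f ts] ha E; first by exists x.
by have := term_size_fill_ge u ha; have := hole_app_term_size ha; rewrite E; lia.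
Qed.

(** The restriction on right-hand sides enters through this dichotomy: an assignment either stores a
    constant or wraps one context around the value of a single variable. *)
Lemma single_var_fill t : at_most_one_var t ->
  ~~ hole t \/
  exists2 y, y \in occurrences t & forall s, subst s t = fill t (s y).
Proof.
rewrite /at_most_one_var => le1; case ht: (hole t); [right|by left].
move: ht; rewrite /hole; case E: (occurrences t) => [//|y l] _.
exists y; first by rewrite inE eqxx.
move=> s; apply: subst_eq_in => x xin.
have yu : y \in undup (occurrences t) by rewrite mem_undup E inE eqxx.
have: x \in undup (occurrences t) by rewrite mem_undup.
move: le1 yu; case: (undup _) => [|z [|]] //= _.
by rewrite !inE => /eqP yz /eqP xz; rewrite xz yz.
Qed.

Fixpoint subterms t : seq (term Omega) :=
  t :: (if t is App _ ts then flatten (map subterms ts) else [::]).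

Lemma subterms_refl t : t \in subterms t.
Proof. by case: t => *; rewrite inE eqxx. Qed.

Lemma subterms_arg f ts t s : t \in ts -> s \in subterms t -> s \in subterms (App f ts).
Proof.
move=> tin sin; rewrite inE; apply/orP; right; apply/flattenP.
by exists (subterms t) => //; apply: map_f.
Qed.

Lemma subterms_var s x : s \in subterms (V x) -> s = V x.
Proof. by rewrite mem_seq1 => /eqP. Qed.

Lemma subterms_appP s f ts : s \in subterms (App f ts) ->
  s = App f ts \/ exists2 t, t \in ts & s \in subterms t.
Proof.
rewrite inE => /orP[/eqP|/flattenP[l /mapP[t tin ->] st]]; first by left.
by right; exists t.
Qed.

Lemma subterms_trans s t u : s \in subterms t -> t \in subterms u -> s \in subterms u.
Proof.
elim/term_in_ind: u => [x|f ts IH] st; first by move/subterms_var <-.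
case/subterms_appP => [<-//|[u uin tu]].
by apply: (subterms_arg _ uin); apply: IH.
Qed.

Lemma subterms_nohole s t : s \in subterms t -> ~~ hole t -> ~~ hole s.
Proof.
elim/term_in_ind: t => [x|f ts IH]; first by [].
case/subterms_appP => [->//|[u uin tu]].
by rewrite hole_app => /hasPn/(_ _ uin); apply: IH.
Qed.

Lemma size_subterms t : size (subterms t) = term_size t.
Proof.
elim/term_in_ind: t => [x|f ts IH] //=; rewrite size_flatten /shape -map_comp.
by congr (sumn _).+1; apply/eq_in_map => t /IH.
Qed.

Lemma subterm_fill a u : hole a -> u \in subterms (fill a u).
Proof.
elim/term_in_ind: a => [x|f ts IH] ha; first exact: subterms_refl.
move: ha; rewrite hole_app => /hasP[t tin ht].
by apply: (@subterms_arg f _ (fill t u)); [apply: map_f | apply: IH].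
Qed.

(** [S] will list the ground subterms of the right-hand sides. A term outside [S] then has no ground
    copy inside a small context; wherever it appears after filling, a hole is involved. *)
Definition small S t := all (fun s => hole s || (s \in S)) (subterms t).

Lemma small_subterm S s t : s \in subterms t -> small S t -> small S s.
Proof.
move=> st /allP Ht; apply/allP => u us; apply: Ht; exact: subterms_trans us st.
Qed.

Lemma small_arg S f ts t : t \in ts -> small S (App f ts) -> small S t.
Proof. by move=> tin; apply/small_subterm/(subterms_arg _ tin)/subterms_refl. Qed.

Lemma small_mem S t : small S t -> ~~ hole t -> t \in S.
Proof. by move=> /allP/(_ t (subterms_refl t)) /orP[->|]. Qed.

Lemma small_fill_l S a c : small S (fill a c) -> small S a.
Proof.
elim/term_in_ind: a => [x|f ts IH]; first by [].
move=> sm; apply/allP => s /subterms_appP[->|].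
  case hs: (hole _) => //=; apply: small_mem; last by rewrite hs.
  by rewrite -(nohole_subst (fun=> c) (negbT hs)).
move=> [t tin st].
have: small S t by apply: IH => //; apply: small_arg sm; apply: map_f.
by move/allP => /(_ s st).
Qed.

Lemma small_fill_r S a c : hole a -> small S (fill a c) -> small S c.
Proof. by move=> ha; apply: small_subterm; apply: subterm_fill. Qed.

(** The holes can be read off from the result: they are the occurrences of [v]. Elsewhere a
    subcontext producing [v] would be ground, hence in [S], or would properly enlarge [v]. *)
Lemma fill_cancel_small S c d u v :
  normalized c -> normalized d -> small S c -> small S d -> v \notin S ->
  fill c v = u -> fill d v = u -> c = d.
Proof.
move=> + + + + vS <-.
have vx e : normalized e -> small S e -> fill e v = v -> e = V 0.
  move=> ne se; case he: (hole e); last first.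
    rewrite /fill nohole_subst ?he // => E.
    by move: vS; rewrite -E (small_mem se) ?he.
  by move=> /(fill_loop he)[x E]; move: ne; rewrite E /normalized /= => /eqP.
elim/term_in_ind: c d => [x|f ts IH] d.
  by move=> /eqP /= [<-] nd _ sd /(vx _ nd sd).
case: d => [x nc /eqP /= [<-] sc _|g ss].
  by move=> E; apply: vx.
rewrite !normal_app => /allP nts /allP nss sc sd /= [-> E]; congr App.
have sz : size ss = size ts by move/(congr1 size): E; rewrite !size_map.
apply: (@eq_from_nth _ (V 0)) => // i ilt.
have tin := mem_nth (V 0) ilt.
have sin : nth (V 0) ss i \in ss by apply: mem_nth; rewrite sz.
apply: (IH _ tin).
- exact: nts.
- exact: nss.
- exact: small_arg tin sc.
- exact: small_arg sin sd.
by move/(congr1 (fun l => nth (V 0) l i)): E; rewrite !(nth_map (V 0)) ?sz.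
Qed.

(** * Overlaps of small contexts *)

Section Overlap.
Variables (S : seq (term Omega)) (u v : term Omega).
Hypotheses (uS : u \notin S) (vS : v \notin S) (vu : term_size v <= term_size u).

(** Descend to a hole of [a]. The context [b] cannot reach its own hole earlier, since [v] would
    then properly contain the larger term [u]; what remains of [b] at that place is [c]. *)
Lemma overlap_exists a b :
  normalized a -> normalized b -> small S a -> small S b -> hole a ->
  fill a u = fill b v ->
  exists c, [/\ normalized c, small S c & fill c v = u].
Proof.
elim/term_in_ind: a b => [x|f ts IH] b na nb sa sb ha E; first by exists b.
case: b nb sb E => [x|g ss] nb sb E.
  have := term_size_fill_ge u ha; have := hole_app_term_size ha; rewrite E [fill (V x) v]/fill [subst _ _]/=; lia.
move: ha; rewrite hole_app => /hasP[t tin ht].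
have /(nthP (V 0))[i ilt Et] := tin.
move: E => /= [Efg E].
have sz : size ss = size ts by move/(congr1 size): E; rewrite !size_map.
have sin : nth (V 0) ss i \in ss by apply: mem_nth; rewrite sz.
apply: (IH t tin (nth (V 0) ss i)) => //.
- by move: na; rewrite normal_app => /allP/(_ t tin).
- by move: nb; rewrite normal_app => /allP/(_ _ sin).
- exact: small_arg tin sa.
- exact: small_arg sin sb.
by move/(congr1 (fun l => nth (V 0) l i)): E; rewrite !(nth_map (V 0)) ?sz // Et.
Qed.

(** At every hole of [a] the rest of [b] sends [v] to [u], so it is [c] by cancellation. Where [b]
    is ground but [a] is not, [u] would be a ground subterm of [b] and hence in [S]; the opposite
    mismatch puts [v] in [S] or contradicts the sizes. *)
Lemma overlap_factor c a b :
  normalized c -> small S c -> fill c v = u ->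
  normalized a -> normalized b -> small S a -> small S b ->
  fill a u = fill b v -> b = fill a c.
Proof.
move=> nc sc Ec; elim/term_in_ind: a b => [x|f ts IH] b na nb sa sb E.
  by rewrite /fill /=; apply/esym; apply: (fill_cancel_small nc nb sc sb vS Ec); rewrite -E.
case hb: (hole b); last first.
  have Eb : fill b v = b by rewrite /fill nohole_subst ?hb.
  case ha: (hole (App f ts)); last first.
    by move: E; rewrite Eb /fill !nohole_subst ?ha.
  have: u \in subterms b by rewrite -Eb -E subterm_fill.
  move=> ub; case/negP: uS; apply: (small_mem (small_subterm ub sb)).
  by apply: (subterms_nohole ub); rewrite hb.
case: b nb sb E hb => [x|g ss] nb sb E hb.
  case ha: (hole (App f ts)).
    by have := term_size_fill_ge u ha; have := hole_app_term_size ha; rewrite E [fill (V x) v]/fill [subst _ _]/=; lia.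
  move: E; rewrite /fill nohole_subst ?ha //= => E.
  by move: vS; rewrite -E (small_mem sa) ?ha.
move: E => /= [-> E]; rewrite /fill /=; congr App.
have sz : size ss = size ts by move/(congr1 size): E; rewrite !size_map.
apply: (@eq_from_nth _ (V 0)); first by rewrite size_map.
move=> i; rewrite sz => ilt; rewrite (nth_map (V 0)) //.
have tin := mem_nth (V 0) ilt.
have sin : nth (V 0) ss i \in ss by apply: mem_nth; rewrite sz.
apply: IH => //.
- by move: na; rewrite normal_app => /allP/(_ _ tin).
- by move: nb; rewrite normal_app => /allP/(_ _ sin).
- exact: small_arg tin sa.
- exact: small_arg sin sb.
by move/(congr1 (fun l => nth (V 0) l i)): E; rewrite !(nth_map (V 0)) ?sz.
Qed.
End Overlap.

(** The primes of the monoid of one-variable contexts under filling, whose unit is [V 0]. *)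
Definition irreducible c :=
  [/\ hole c, normalized c, c != V 0 &
      forall a b, hole a -> normalized a -> hole b -> normalized b ->
        c = fill a b -> a = V 0 \/ b = V 0].

(** If [v] is the smaller term, then [b] factors through [a], and irreducibility of [b] leaves only
    the trivial cofactor. For [a = f(x, c)] and [b = f(c, x)] with [u = v = c] this fails, but then
    [c] is in [S]. *)
Lemma irreducible_overlap S a b u v :
  irreducible a -> irreducible b -> small S a -> small S b ->
  u \notin S -> v \notin S -> fill a u = fill b v -> a = b /\ u = v.
Proof.
wlog vu : a b u v / term_size v <= term_size u => [H|] ia ib sa sb uS vS E.
  case/orP: (leq_total (term_size v) (term_size u)) => le; first exact: H.
  by have [-> ->] := H b a v u le ib ia sb sa vS uS (esym E).
case: (ia) (ib) => ha na a0 _ [hb nb b0 irb].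
have [c [nc sc Ec]] := overlap_exists uS vS vu na nb sa sb ha E.
have Eb := overlap_factor uS vS vu nc sc Ec na nb sa sb E.
have hc : hole c by move: hb; rewrite Eb hole_fill => /andP[].
case: (irb a c ha na hc nc Eb) => Z; first by rewrite Z eqxx in a0.
have Eab : b = a by rewrite Eb Z fillV0.
by split=> //; apply: (fill_inj ha); rewrite E Eab.
Qed.
End Contexts.

(** * A numbering of terms that is affine on contexts *)

Section Numbering.
Variables (Omega : countType) (S : seq (term Omega)).
Implicit Types (t u g r : term Omega).
Notation V := (Var Omega).

Definition peel t (gu : term Omega * term Omega) :=
  [/\ irreducible gu.1, small S gu.1, gu.2 \notin S & t = fill gu.1 gu.2].

(** Even codes for variables make [num (V a) = 4 * a + 1] affine in [a], as needed to reduce all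
    atoms to two; applications get the odd codes. *)
Definition base_code t := if t is Var a then a.*2 else (pickle t).*2.+1.

(* The odd part and the exponent of 2 encode a pair, so that prepending an
   irreducible context is an injective affine map, also for infinitely many
   contexts. *)
Fixpoint num_fuel k t : nat :=
  if k is k'.+1 then
    if excluded_middle_informative (exists gu, peel t gu) then
      let gu := epsilon (inhabits (t, t)) (peel t) in
      2 ^ (pickle gu.1).+1 * (num_fuel k' gu.2).*2.+1
    else (base_code t).*2.+1
  else 0.

Definition num t := num_fuel (term_size t) t.

Lemma irreducible_term_size g : irreducible g -> 1 < term_size g.
Proof.
case=> hg ng g0 _; case: g hg ng g0 => [x _ /eqP /= [<-]|f ts hg _ _].
  by rewrite eqxx.
exact: hole_app_term_size.
Qed.

Lemma peel_term_size t gu : peel t gu -> term_size gu.2 < term_size t.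
Proof.
case=> ig _ _ ->; have := irreducible_term_size ig; case: ig => hg _ _ _.
have := term_size_fill_ge gu.2 hg; lia.
Qed.

Lemma num_fuel_enough k k' t :
  term_size t <= k -> term_size t <= k' -> num_fuel k t = num_fuel k' t.
Proof.
elim: k k' t => [|k IH] [|k'] t /=; try by have := term_size_gt0 t; lia.
case: excluded_middle_informative => // ex lek lek'.
have := epsilon_spec (inhabits (t, t)) _ ex => /peel_term_size lt.
by rewrite (IH k') //; lia.
Qed.

(** The factorization picked by [epsilon] must be the given one, by [irreducible_overlap]. For fixed
    [g] the right-hand side is affine in [num u]. *)
Lemma num_fill g u : irreducible g -> small S g -> u \notin S ->
  num (fill g u) = 2 ^ (pickle g).+1 * (num u).*2.+1.
Proof.
move=> ig sg uS; set t := fill g u.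
have pt : peel t (g, u) by split.
rewrite {1}/num; case E: (term_size t) => [|k]; first by have := term_size_gt0 t; lia.
rewrite /=; case: excluded_middle_informative => [ex|[]]; last by exists (g, u).
have := epsilon_spec (inhabits (t, t)) _ ex; set gu := epsilon _ _.
move=> [ig' sg' uS' Et].
have [<- <-] := irreducible_overlap ig ig' sg sg' uS uS' Et.
by rewrite (@num_fuel_enough _ (term_size u)) //; have := peel_term_size pt; rewrite E /=; lia.
Qed.

Lemma num_base t : ~ (exists gu, peel t gu) -> num t = (base_code t).*2.+1.
Proof.
rewrite /num; case E: (term_size t) => [|k]; first by have := term_size_gt0 t; lia.
by rewrite /=; case: excluded_middle_informative.
Qed.

Lemma num_var a : num (V a) = 4 * a + 1.
Proof.
rewrite num_base /=; first by lia.
move=> [[g u] [/= ig _ _ E]]; have := irreducible_term_size ig.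
case: ig => hg _ _ _; have := term_size_fill_ge u hg; rewrite -E /=.
have := term_size_gt0 u; lia.
Qed.

Lemma num_gt0 t : 0 < num t.
Proof.
case: (excluded_middle_informative (exists gu, peel t gu)) => [[gu [ig sg uS ->]]|H].
  by rewrite num_fill // muln_gt0 expn_gt0.
by rewrite num_base.
Qed.

Lemma base_code_inj : injective base_code.
Proof.
case=> [x|f ts] [y|g ss] /=; try by [lia|move=> E; congr Var; lia].
by move=> E; apply: (pcan_inj pickleK); lia.
Qed.

Lemma expn2_odd_inj i j x y : 2 ^ i * x.*2.+1 = 2 ^ j * y.*2.+1 -> i = j /\ x = y.
Proof.
elim: i j => [|i IH] [|j]; rewrite ?expn0 ?expnS ?mul1n.
- by move=> E; split=> //; lia.
- by set z := 2 ^ j; lia.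
- by set z := 2 ^ i; lia.
by move=> E; have [|-> ->] := IH j; rewrite // -mulnA -mulnA in E; nia.
Qed.

(** The exponent [(pickle g).+1] is positive, so parity tells peeled terms (even) from base terms
    (odd). For peeled terms the exponent recovers the context and the odd part recovers the smaller
    rest. *)
Lemma num_inj : injective num.
Proof.
move=> t; have [n] := ubnP (term_size t); elim: n t => // n IH t ltn u.
case: (excluded_middle_informative (exists gu, peel t gu)) => [[gu pt]|nt];
case: (excluded_middle_informative (exists gu, peel u gu)) => [[gu' pu]|nu].
- have := peel_term_size pt; case: pt pu => [ig sg uS Et] [ig' sg' uS' Eu] lt.
  rewrite Et Eu !num_fill // => /expn2_odd_inj [[/(pcan_inj pickleK) ->] E].
  by rewrite (IH _ _ _ E) //; lia.
- case: pt => [ig sg uS ->]; rewrite num_fill // (num_base nu) expnS -mulnA.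
  by set z := (2 ^ _ * _); lia.
- case: pu => [ig sg uS ->]; rewrite num_fill // (num_base nt) expnS -mulnA.
  by set z := (2 ^ _ * _); lia.
by rewrite !num_base // => E; apply: base_code_inj; lia.
Qed.
End Numbering.

(** * Linear spans of rational-valued functions *)

Section Spans.
Import GRing.Theory.
Local Open Scope ring_scope.
Variable T : Type.
Implicit Types (B : (T -> rat) -> Prop) (F G : T -> rat).

(** The linear span of [B]; pointwise equality is built in, so that functional extensionality is
    avoided. *)
Inductive spanned B : (T -> rat) -> Prop :=
  | spanned0 F : F =1 (fun=> 0) -> spanned B F
  | spanned_step c f F G :
      B f -> spanned B F -> G =1 (fun t => c * f t + F t) -> spanned B G.

Lemma spanned_ext B F G : spanned B F -> G =1 F -> spanned B G.
Proof.
case=> [{}F F0|c f {}F H Bf sF E] GF; first by apply: spanned0 => t; rewrite GF F0.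
by apply: (spanned_step Bf sF (c := c)) => t; rewrite GF E.
Qed.

Lemma spanned_lin B c F G :
  spanned B F -> spanned B G -> spanned B (fun t => c * F t + G t).
Proof.
elim=> [{}F F0|d f {}F H Bf sF IH E] sG.
  by apply: spanned_ext sG _ => t; rewrite F0 mulr0 add0r.
by apply: (spanned_step Bf (IH sG) (c := c * d)) => t; rewrite E; ring.
Qed.

Lemma spanned_in B f : B f -> spanned B f.
Proof.
move=> Bf; apply: (spanned_step Bf (c := 1) (@spanned0 _ (fun=> 0) _)) => // t.
by rewrite mul1r addr0.
Qed.

Lemma spanned_scale B c F : spanned B F -> spanned B (fun t => c * F t).
Proof.
move=> sF; apply: spanned_ext (spanned_lin c sF (@spanned0 _ (fun=> 0) _)) _ => // t.
by rewrite addr0.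
Qed.

Lemma spanned_sub B F G :
  spanned B F -> spanned B G -> spanned B (fun t => F t - G t).
Proof.
move=> sF sG; apply: spanned_ext (spanned_lin (-1) sG sF) _ => t; ring.
Qed.
End Spans.

Lemma spanned_comp (T U : Type) (B : (T -> rat) -> Prop) (C : (U -> rat) -> Prop)
    (h : U -> T) F :
  (forall f, B f -> spanned C (f \o h)) -> spanned B F -> spanned C (F \o h).
Proof.
move=> H; elim=> [{}F F0|c f {}F G Bf sF IH E].
  by apply: spanned0 => u; rewrite /= F0.
by apply: spanned_ext (spanned_lin c (H f Bf) IH) _ => u; rewrite /= E.
Qed.

(** * Functions of terms whose span is stable under filling *)

Section TermFunctions.
Import GRing.Theory.
Local Open Scope ring_scope.
Variables (Omega : countType) (S : seq (term Omega)) (P : seq (seq nat)).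
Hypothesis S_nohole : forall g, g \in S -> ~~ hole g.
Hypothesis S_sub : forall g s, g \in S -> s \in subterms g -> s \in S.
Hypothesis P_nil : [::] \in P.
Hypothesis P_behead : forall i p, i :: p \in P -> p \in P.
Implicit Types (t u g r : term Omega).
Notation V := (Var Omega).

Fixpoint sub_at (p : seq nat) t : option (term Omega) :=
  if p is i :: p' then
    if t is App _ ts then obind (sub_at p') (onth ts i) else None
  else Some t.

(** The value 0 marks a missing position; no term has this number, by [num_gt0]. *)
Definition num_at p t : rat := if sub_at p t is Some u then (num S u)%:R else 0.
(** The number of arguments is coded with the symbol because raw terms may violate the ranks; the
    successor reserves 0 for variables and missing positions. *)
Definition head_at p t : rat :=
  if sub_at p t is Some (App f ts) then (pickle (f, size ts)).+1%:R else 0.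
Definition is_term g t : rat := (t == g)%:R.

(** The part of [basic] that describes a term as a whole. It is already stable under filling, which
    permits the induction on factorizations in [num_fill_spanned] before positions are
    considered. *)
Inductive basic0 : (term Omega -> rat) -> Prop :=
  | basic0_one : basic0 (fun=> 1)
  | basic0_num : basic0 (num_at [::])
  | basic0_is g : g \in S -> basic0 (is_term g).

Inductive basic : (term Omega -> rat) -> Prop :=
  | basic_one : basic (fun=> 1)
  | basic_is g : g \in S -> basic (is_term g)
  | basic_num p : p \in P -> basic (num_at p)
  | basic_head p : p \in P -> basic (head_at p).

Lemma spanned_const (B : (term Omega -> rat) -> Prop) c :
  B (fun=> 1) -> spanned B (fun=> c).
Proof.
move=> B1; apply: spanned_ext (spanned_scale c (spanned_in B1)) _ => t.
by rewrite mulr1.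
Qed.

(** Finitely many exceptional values are repaired by the indicators of the exceptions; this absorbs
    the failure of [num_fill] on [S]. *)
Lemma spanned_outside F G (l : seq (term Omega)) : {subset l <= S} ->
  (forall t, t \notin l -> F t = G t) -> spanned basic0 G -> spanned basic0 F.
Proof.
elim: l G => [|g l IH] G sub E sG; first exact: spanned_ext sG (fun t => E t isT).
have sub' : {subset l <= S} by move=> x xl; apply: sub; rewrite inE xl orbT.
apply: (IH (fun t => (F g - G g) * is_term g t + G t)) => // [t tl|].
  rewrite /is_term; case: eqVneq => [->|tg]; first by rewrite mulr1; ring.
  by rewrite mulr0 add0r E // inE negb_or tg.
by apply: spanned_lin sG; apply: spanned_in; constructor; apply/sub/mem_head.
Qed.

(** Filling is injective, so at most one term is sent to [g]. That term is a subterm of [g] and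
    hence again in [S]. *)
Lemma is_term_fill r g : hole r -> g \in S -> spanned basic0 (is_term g \o fill r).
Proof.
move=> hr gS; case E: (has (fun u => fill r u == g) (subterms g)).
  have /hasP[u ug /eqP Eu] := E.
  apply: (@spanned_ext _ _ (is_term u)).
    by apply: spanned_in; constructor; apply: S_sub gS ug.
  move=> t; rewrite /is_term /= -Eu; congr (_ : bool)%:R.
  by apply/eqP/eqP => [/(fill_inj hr)|->].
apply: spanned0 => t; rewrite /is_term /=; case: eqP => // Et.
by case/hasP: E; exists t; [rewrite -Et subterm_fill | rewrite Et].
Qed.

(** An irreducible context is affine outside [S]; a reducible one is a composition of two smaller
    contexts, and spans compose. *)
Lemma num_fill_spanned r : hole r -> normalized r -> small S r ->
  spanned basic0 (num_at [::] \o fill r).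
Proof.
have [n] := ubnP (term_size r); elim: n r => // n IH r ltn hr nr sr.
case: (eqVneq r (V 0)) => [->|r0].
  apply: spanned_ext (spanned_in basic0_num) _ => t //.
case: (excluded_middle_informative (irreducible r)) => [ir|nir].
  set c : rat := (2 ^ (pickle r).+1)%:R.
  apply: (@spanned_outside _ (fun t => (c * 2) * num_at [::] t + c) S) => //.
    by move=> t tS; rewrite /= /num_at /= num_fill // natrM -/c -addn1 natrD -muln2 natrM; ring.
  apply: spanned_lin; first exact: spanned_in basic0_num.
  exact: spanned_const basic0_one.
have [a [b [ha na hb nb [Er a0 b0]]]] : exists a b,
    [/\ hole a, normalized a, hole b, normalized b & [/\ r = fill a b, a <> V 0 & b <> V 0]].
  apply: NNPP => H; apply: nir; split=> // a b ha na hb nb E.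
  apply: NNPP => /not_or_and [a0 b0]; apply: H; exists a, b; split=> //.
have gt1 c : hole c -> normalized c -> c <> V 0 -> (1 < term_size c)%N.
  case: c => [x _ /eqP /= [<-]//|f ts] h _ _; exact: hole_app_term_size.
have := term_size_fill_ge b ha; rewrite -Er => le.
have := gt1 a ha na a0; have := gt1 b hb nb b0 => lta ltb.
have sa : small S a by apply: (@small_fill_l _ _ _ b); rewrite -Er.
have sb : small S b by apply: (@small_fill_r _ _ a) => //; rewrite -Er.
have := IH a _ ha na sa => sA; have := IH b _ hb nb sb => sB.
apply: (@spanned_ext _ _ ((num_at [::] \o fill a) \o fill b)); last first.
  by move=> t; rewrite /= Er fill_fill.
apply: (spanned_comp _ (sA _)); last by lia.
move=> f [||g gS]; first exact: spanned_const basic0_one.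
  by apply: sB; lia.
exact: is_term_fill.
Qed.

Lemma basic0_spanned F : spanned basic0 F -> spanned basic F.
Proof.
apply: (@spanned_comp _ _ basic0 basic id) => f [||g gS]; apply: spanned_in.
- exact: basic_one.
- exact: (basic_num P_nil).
exact: (basic_is gS).
Qed.

Lemma small_norm r : small S r -> small S (fill r (V 0)).
Proof.
elim/term_in_ind: r => [x|f ts IH] // sr; apply/allP => s /subterms_appP [->|].
  case hs: (hole _) => //=.
  have hr : ~~ hole (App f ts)
    by move: (hole_fill (App f ts) (V 0)); rewrite andbT => <-; apply: negbT.
  by rewrite -/(subst (fun=> V 0) (App f ts)) nohole_subst // (small_mem sr).
move=> [t /mapP[u uin ->] st].
by have /allP/(_ s st) := IH u uin (small_arg uin sr).
Qed.

(** Follow [p] inside [r]. If it meets the hole, the rest of the position is read in the filler,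
    which is why [P] is closed under removing the first index; if it ends inside [r], the number of
    a filled subcontext remains. *)
Lemma num_at_fill p r : p \in P -> small S r -> normalized r ->
  spanned basic (num_at p \o fill r).
Proof.
elim: p r => [|i p IH] r pP sr nr.
  case hr: (hole r); first exact/basic0_spanned/num_fill_spanned.
  apply: (@spanned_ext _ _ (fun=> (num S r)%:R)).
    exact: spanned_const basic_one.
  by move=> t; rewrite /num_at /= /fill nohole_subst ?hr.
case: r sr nr => [x|f ts] sr nr; first exact/spanned_in/basic_num.
case E: (onth ts i) => [c|]; last first.
  by apply: spanned0 => t; rewrite /num_at /= onth_map E.
have cin : c \in ts by apply/onthP; exists i.
apply: (spanned_ext (IH c (P_behead pP) (small_arg cin sr) _)).
  by move: nr; rewrite normal_app => /allP/(_ _ cin).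
by move=> t; rewrite /num_at /= onth_map E.
Qed.

Lemma head_at_fill p r : p \in P -> spanned basic (head_at p \o fill r).
Proof.
elim: p r => [|i p IH] [x|f ts] pP.
- exact: (spanned_in (basic_head pP)).
- apply: spanned_ext (spanned_const _ basic_one) _ => t.
  by rewrite /head_at /= size_map.
- exact: (spanned_in (basic_head pP)).
case E: (onth ts i) => [c|]; last first.
  by apply: spanned0 => t; rewrite /head_at /= onth_map E.
apply: (spanned_ext (IH c (P_behead pP))).
by move=> t; rewrite /head_at /= onth_map E.
Qed.

Lemma basic_fill r f : small S r -> hole r -> basic f -> spanned basic (f \o fill r).
Proof.
move=> sr hr Bf; apply: (@spanned_ext _ _ (f \o fill (fill r (V 0)))); last first.
  by move=> t; rewrite /= fill_norm.
have sr' := small_norm sr.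
have nr' : normalized (fill r (V 0)) by apply: normal_fill; rewrite /normalized.
have hr' : hole (fill r (V 0)) by rewrite hole_fill hr.
case: Bf => [|g gS|p pP|p pP].
- exact: spanned_const basic_one.
- exact/basic0_spanned/is_term_fill.
- exact: num_at_fill.
exact: head_at_fill.
Qed.

(* Values at atoms are affine in the index of the atom, so that two atoms
   represent all of them. *)
Lemma basic_atom f a : basic f ->
  f (V a) = (1 - a%:R) * f (V 0) + a%:R * f (V 1).
Proof.
case=> [|g gS|p pP|p pP]; first by ring.
- have ng b : is_term g (V b) = 0.
    by rewrite /is_term; case: eqP => // E; have := S_nohole gS; rewrite -E.
  by rewrite !ng; ring.
- case: p pP => [|i p] pP; rewrite /num_at /=; last by ring.
  by rewrite !num_var !natrD !natrM; ring.
by case: p pP => [|i p] pP; rewrite /head_at /=; ring.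
Qed.
End TermFunctions.

(** * Linear spans of words of matrices *)

Section Words.
Variable Omega : countType.
Notation V := (Var Omega).

Inductive op := OSet of nat & term Omega | OAtom of nat & nat.

Definition store := seq (term Omega).

Definition run1 (st : store) (o : op) : store :=
  match o with
  | OSet x r => set_nth (V 0) st x (subst (nth (V 0) st) r)
  | OAtom x a => set_nth (V 0) st x (V a)
  end.

Definition run (st : store) (w : seq op) : store := foldl run1 st w.

Lemma run_cat st w w' : run st (w ++ w') = run (run st w) w'.
Proof. exact: foldl_cat. Qed.
End Words.

Section TraceClosure.
Import GRing.Theory.
Local Open Scope ring_scope.
Variables (A : Type) (D : nat) (mx : A -> 'M[rat]_D).
Implicit Types (w : seq A) (W : seq A -> Prop).

(** Row-vector convention: the operation executed first is the leftmost factor. *)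
Definition mxw w : 'M[rat]_D := foldr (fun a M => mx a *m M) 1%:M w.

Lemma mxw_cat w w' : mxw (w ++ w') = mxw w *m mxw w'.
Proof. by elim: w => [|a w IH] /=; rewrite ?mul1mx // IH mulmxA. Qed.

(* Membership in the linear span of the matrices of [W], expressed by duality. *)
Definition cl W w := forall C : 'M[rat]_D,
  (forall w', W w' -> \tr (C *m mxw w') = 0) -> \tr (C *m mxw w) = 0.

Lemma cl_in W w : W w -> cl W w.
Proof. by move=> Ww C; apply. Qed.

Lemma cl_cl W W' w : (forall w', W' w' -> cl W w') -> cl W' w -> cl W w.
Proof. by move=> sub clw C HC; apply: clw => w' /sub; apply. Qed.

(** Multiplication is bilinear: with one factor fixed, cyclicity of the trace absorbs it into the
    functional [C], so the two factors can be treated one after the other. *)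
Lemma cl_cat W1 W2 W w1 w2 :
  (forall u v, W1 u -> W2 v -> W (u ++ v)) -> cl W1 w1 -> cl W2 w2 -> cl W (w1 ++ w2).
Proof.
have rot (X Y Z : 'M[rat]_D) : \tr (X *m (Y *m Z)) = \tr (Z *m X *m Y).
  by rewrite mulmxA mxtrace_mulC mulmxA.
move=> sub cl1 cl2 C HC; rewrite mxw_cat mulmxA.
apply: cl2 => v Wv; rewrite -mulmxA rot; apply: cl1 => u Wu.
by rewrite -rot -mxw_cat; apply/HC/sub.
Qed.

Section Chain.
Variables (N : finType) (W : nat -> N -> seq A -> Prop).
Hypothesis W_mono : forall k X w, W k X w -> W k.+1 X w.

Lemma W_le k k' X w : (k <= k')%N -> W k X w -> W k' X w.
Proof. by move=> /subnKC <-; elim: (_ - _)%N => [|d IH]; rewrite ?addn0 // addnS => /IH/W_mono. Qed.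

(* The witnesses of instability form a triangular matrix of full rank that
   factors through a space of dimension [#|N| * D * D]. *)
Lemma unstable_bound K :
  (forall k, (k < K)%N -> exists X w, W k.+1 X w /\ ~ cl (W k X) w) ->
  (K <= #|N| * (D * D))%N.
Proof.
move=> H.
have /fin_all_exists[f Hf] : forall k : 'I_K, exists t : N * seq A * 'M[rat]_D,
    [/\ W k.+1 t.1.1 t.1.2, forall w, W k t.1.1 w -> \tr (t.2 *m mxw w) = 0
      & \tr (t.2 *m mxw t.1.2) != 0].
  move=> k; have [X [w [Ww ncl]]] := H k (ltn_ord k).
  have [C HC] := not_all_ex_not _ _ ncl.
  have [C0 /eqP C1] := imply_to_and _ _ HC.
  by exists (X, w, C).
(* The trace pairing of functional [k] with word [j], set to 0 if they belong to different elements
   of [N], is a dot product over [I]. *)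
pose I : finType := (N * ('I_D * 'I_D))%type.
pose L : 'M[rat]_(K, #|I|) := \matrix_(k, i)
  (((f k).1.1 == (enum_val i).1)%:R * (f k).2 (enum_val i).2.1 (enum_val i).2.2).
pose R : 'M[rat]_(#|I|, K) := \matrix_(i, k)
  (((f k).1.1 == (enum_val i).1)%:R * mxw (f k).1.2 (enum_val i).2.2 (enum_val i).2.1).
have G k j : (L *m R) k j =
    ((f k).1.1 == (f j).1.1)%:R * \tr ((f k).2 *m mxw (f j).1.2).
  rewrite mxE; under eq_bigr do rewrite !mxE.
  rewrite -(big_enum_val (A := I) (fun i : I => ((f k).1.1 == i.1)%:R * (f k).2 i.2.1 i.2.2 *
     (((f j).1.1 == i.1)%:R * mxw (f j).1.2 i.2.2 i.2.1))) /=.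
  rewrite (eq_bigl predT) // -(pair_bigA _ (fun X (p : 'I_D * 'I_D) =>
     ((f k).1.1 == X)%:R * (f k).2 p.1 p.2 *
     (((f j).1.1 == X)%:R * mxw (f j).1.2 p.2 p.1))) /=.
  rewrite (bigD1 (f k).1.1) //= [X in _ + X]big1 ?addr0 => [|X]; last first.
    rewrite eq_sym => /negPf ne; apply: big1 => p _; by rewrite ne !mul0r.
  rewrite eqxx [in RHS]eq_sym; case: eqP => _; last first.
    by rewrite mul0r; apply: big1 => p _; rewrite mul0r mulr0.
  rewrite -(pair_bigA _ (fun a b => 1%:R * (f k).2 a b *
     (1%:R * mxw (f j).1.2 b a))) mul1r /= /mxtrace.
  by apply: eq_bigr => a _; rewrite mxE; apply: eq_bigr => b _; rewrite !mul1r.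
(* For [j < k] the word of step [j] already lies in [W k], where the functional of step [k]
   vanishes; on its own word that functional is nonzero. *)
have tri : is_trig_mx (L *m R)^T.
  apply/is_trig_mxP => j k ltjk; rewrite mxE G.
  case: eqP => [E|]; last by rewrite mul0r.
  have [_ Ck _] := Hf k; have [Wj _ _] := Hf j; rewrite Ck ?mulr0 //.
  by rewrite E; apply: W_le Wj.
have: \rank (L *m R) = K.
  apply: mxrank_unit; rewrite -unitmx_tr unitmxE det_trig // unitfE.
  apply/prodf_neq0 => k _; rewrite mxE G eqxx mul1r; by case: (Hf k).
by move=> <-; apply: leq_trans (mxrankM_maxl _ _) _; rewrite (leq_trans (rank_leq_col _)) // !card_prod !card_ord.
Qed.

Lemma chain_stable : exists2 k, (k <= #|N| * (D * D))%N &
  forall X w, W k.+1 X w -> cl (W k X) w.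
Proof.
apply: NNPP => H; suff: ((#|N| * (D * D)).+1 <= #|N| * (D * D))%N by rewrite ltnn.
apply: unstable_bound => k; rewrite ltnS => lek.
apply: NNPP => H'; apply: H; exists k => // X w Ww.
by apply: NNPP => ncl; apply: H'; exists X, w.
Qed.
End Chain.
End TraceClosure.

(** * Linear representation of assignments *)

Section Representation.
Import GRing.Theory Num.Theory.
Local Open Scope ring_scope.
Variables (Omega : countType) (n : nat) (S : seq (term Omega)) (P : seq (seq nat)).
Hypothesis S_nohole : forall g, g \in S -> ~~ hole g.
Hypothesis S_sub : forall g s, g \in S -> s \in subterms g -> s \in S.
Hypothesis P_nil : [::] \in P.
Hypothesis P_behead : forall i p, i :: p \in P -> p \in P.
Notation V := (Var Omega).
Notation val st x := (nth (V 0%N) st x).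

(* Cell [n] is never assigned: it carries the constant function 1. *)
Inductive coord : (store Omega -> rat) -> Prop :=
  | Coord x f : (x <= n)%N -> basic S P f -> coord (fun st => f (val st x)).

Definition wf_op (o : op Omega) : bool :=
  match o with
  | OSet x r => [&& x < n, at_most_one_var r, small S r & all (ltn^~ n) (occurrences r)]%N
  | OAtom x _ => (x < n)%N
  end.

Lemma coord_const c : spanned coord (fun=> c).
Proof.
have C1 : coord (fun=> 1) by apply: (Coord (leqnn n) (basic_one _ _)).
by apply: spanned_ext (spanned_scale c (spanned_in C1)) _ => st; rewrite mulr1.
Qed.

Lemma coord_val F x : (x <= n)%N ->
  spanned (basic S P) F -> spanned coord (fun st => F (val st x)).
Proof.
move=> le; apply: (@spanned_comp _ _ _ coord (fun st => val st x)) => f Bf.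
exact/spanned_in/Coord.
Qed.

(** Only the assigned cell matters. Its new content is constant or a context around the single cell
    [z], so [basic_fill] expresses the function through coordinates of [z]. *)
Lemma coord_run1 o F : wf_op o -> coord F -> spanned coord (fun st => F (run1 st o)).
Proof.
move=> wo [x f lex Bf]; case: o wo => [y r|y a] /=.
  case/and4P=> lty one sr /allP vars; case: (eqVneq x y) => [<-|ne]; last first.
    apply: spanned_ext (spanned_in (Coord lex Bf)) _ => st.
    by rewrite nth_set_nth /= (negPf ne).
  case hr: (hole r); last first.
    apply: spanned_ext (coord_const (f r)) _ => st.
    by rewrite nth_set_nth /= eqxx nohole_subst ?hr.
  have [|[z zin E]] := single_var_fill one; first by rewrite hr.
  apply: spanned_ext (coord_val (ltnW (vars z zin)) (basic_fill S_sub P_nil P_behead sr _ Bf)) _ => //.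
  by move=> st; rewrite nth_set_nth /= eqxx E.
move=> lty; case: (eqVneq x y) => [<-|ne].
  by apply: spanned_ext (coord_const (f (V a))) _ => st; rewrite nth_set_nth /= eqxx.
apply: spanned_ext (spanned_in (Coord lex Bf)) _ => st.
by rewrite nth_set_nth /= (negPf ne).
Qed.

(** The dimension must be explicit because it enters the bound on the search; repetitions in [S] or
    [P] merely enlarge it. *)
Definition feature : finType :=
  ('I_n.+1 * (unit + 'I_(size S) + ('I_(size P) + 'I_(size P))))%type.

Definition feature_fun (i : feature) : term Omega -> rat :=
  match i.2 with
  | inl (inl _) => fun=> 1
  | inl (inr g) => is_term (nth (V 0%N) S g)
  | inr (inl p) => num_at S (nth [::] P p)
  | inr (inr p) => head_at (nth [::] P p)
  end.

Definition dim := #|feature|.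

Lemma dimE : dim = (n.+1 * (1 + size S + (size P + size P)))%N.
Proof. by rewrite /dim !card_prod !card_sum !card_ord card_unit. Qed.

Definition Phi (st : store Omega) : 'rV[rat]_dim :=
  \row_k feature_fun (enum_val k) (val st (enum_val k).1).

Lemma feature_basic (i : feature) : basic S P (feature_fun i).
Proof. by case: i => x [[u|g]|[p|p]]; [exact: basic_one|..]; constructor; exact: mem_nth. Qed.

Lemma feature_coord (i : feature) : coord (fun st => feature_fun i (val st i.1)).
Proof.
apply: Coord; last exact: feature_basic.
by rewrite -ltnS.
Qed.

Lemma coord_feature F : coord F ->
  exists i : feature, forall st, F st = feature_fun i (val st i.1).
Proof.
case=> x f lex; have x'P : (x < n.+1)%N by []; pose x' : 'I_n.+1 := Ordinal x'P; case=> [|g gS|p pP|p pP].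
- by exists (x', inl (inl tt)).
- have lt : (index g S < size S)%N by rewrite index_mem.
  by exists (x', inl (inr (Ordinal lt))) => st; rewrite /feature_fun /= nth_index.
- have lt : (index p P < size P)%N by rewrite index_mem.
  by exists (x', inr (inl (Ordinal lt))) => st; rewrite /feature_fun /= nth_index.
have lt : (index p P < size P)%N by rewrite index_mem.
by exists (x', inr (inr (Ordinal lt))) => st; rewrite /feature_fun /= nth_index.
Qed.

Lemma spanned_Phi F : spanned coord F ->
  exists l : 'cV[rat]_dim, forall st, F st = (Phi st *m l) 0 0.
Proof.
elim=> [{}F F0|c f {}F G /coord_feature[i Ei] _ [l El] E].
  by exists 0 => st; rewrite F0 mulmx0 mxE.
exists (c *: delta_mx (enum_rank i) 0 + l) => st.
by rewrite E El mulmxDr mxE -scalemxAr mxE -colE !mxE enum_rankK Ei.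
Qed.

Lemma run1_mx o : wf_op o ->
  exists M : 'M[rat]_dim, forall st, Phi (run1 st o) = Phi st *m M.
Proof.
move=> wo.
have /fin_all_exists[l Hl] : forall k : 'I_dim, exists l : 'cV[rat]_dim,
    forall st, Phi (run1 st o) 0 k = (Phi st *m l) 0 0.
  move=> k; have [l Hl] := spanned_Phi (coord_run1 wo (feature_coord (enum_val k))).
  by exists l => st; rewrite mxE.
exists (\matrix_(i, k) l k i 0) => st; apply/rowP => k; rewrite Hl !mxE.
by apply: eq_bigr => i _; rewrite !mxE.
Qed.

Definition run1_mx_of o : 'M[rat]_dim :=
  epsilon (inhabits 0) (fun M => forall st, Phi (run1 st o) = Phi st *m M).

(** A matrix chosen by [run1_mx_of] is determined only on the span of the vectors [Phi st]. Choosing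
    one per atom would not give the identity between matrices used in [cl_atom], so the matrix of an
    atom is defined as the affine combination of two choices. *)
Definition op_mx (o : op Omega) : 'M[rat]_dim :=
  match o with
  | OSet _ _ => run1_mx_of o
  | OAtom x a => (1 - a%:R) *: run1_mx_of (OAtom Omega x 0)
               + a%:R *: run1_mx_of (OAtom Omega x 1)
  end.

Lemma op_mxP o st : wf_op o -> Phi (run1 st o) = Phi st *m op_mx o.
Proof.
have H o' : wf_op o' -> forall st, Phi (run1 st o') = Phi st *m run1_mx_of o'.
  by move=> /run1_mx wo'; exact: (epsilon_spec (inhabits 0) _ wo').
case: o => [x r|x a] wo; first exact: H.
rewrite mulmxDr -!scalemxAr -!H //; apply/rowP => k; rewrite !mxE.
rewrite /= !nth_set_nth /=; case: eqP => _; last by ring.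
exact/(basic_atom S_nohole)/feature_basic.
Qed.

Lemma op_mx_atom x a : op_mx (OAtom Omega x a) =
  (1 - a%:R) *: op_mx (OAtom Omega x 0) + a%:R *: op_mx (OAtom Omega x 1).
Proof. by rewrite /= subr0 subrr !scale1r !scale0r addr0 add0r. Qed.

Lemma run_mxP w st : all wf_op w -> Phi (run st w) = Phi st *m mxw op_mx w.
Proof.
elim: w st => [|o w IH] st /=; first by rewrite mulmx1.
by case/andP=> wo ww; rewrite IH // op_mxP // mulmxA.
Qed.

Lemma cl_atom (W : seq (op Omega) -> Prop) x a :
  W [:: OAtom Omega x 0] -> W [:: OAtom Omega x 1] -> cl op_mx W [:: OAtom Omega x a].
Proof.
have mx1 o : mxw op_mx [:: o] = op_mx o by rewrite /mxw /= mulmx1.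
move=> W0 W1 C HC; have := HC _ W0; have := HC _ W1; rewrite !mx1 => E1 E0.
by rewrite op_mx_atom mulmxDr -!scalemxAr mxtraceD !mxtraceZ E0 E1 !mulr0 addr0.
Qed.

(* That an equality is a conjunction of linear conditions is stated without
   listing these conditions: some linear functional vanishes on all states
   satisfying the equality, but not on the given state violating it. *)
Definition detects (Q : store Omega -> Prop) st0 :=
  exists2 F, spanned coord F & F st0 <> 0 /\ forall st, Q st -> F st = 0.

Lemma detects_sub (Q Q' : store Omega -> Prop) st0 :
  (forall st, Q' st -> Q st) -> detects Q st0 -> detects Q' st0.
Proof. by move=> sub [F sF [F0 FQ]]; exists F => //; split=> // st /sub; apply: FQ. Qed.

Lemma detects_false (Q : store Omega -> Prop) st0 :
  (forall st, ~ Q st) -> detects Q st0.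
Proof.
move=> H; exists (fun=> 1); first exact: coord_const.
by split=> [|st /H//]; apply/eqP; rewrite oner_eq0.
Qed.

Lemma sub_at_rcons p i (t : term Omega) :
  sub_at (rcons p i) t =
  obind (fun u => if u is App _ ts then onth ts i else None) (sub_at p t).
Proof.
elim: p t => [|j p IH] [x|f ts] //=; first by case: (onth ts i).
by case: (onth ts j) => //= u; rewrite IH.
Qed.

Fixpoint positions (t : term Omega) : seq (seq nat) :=
  [::] :: (if t is App _ ts then
             [seq i :: p | i <- iota 0 (size ts), p <- nth [::] (map positions ts) i]
           else [::]).

Lemma positions_arg f ts i p : (i < size ts)%N -> p \in positions (nth (V 0%N) ts i) ->
  i :: p \in positions (App f ts).
Proof.
move=> lt pin; rewrite inE; apply/orP; right; apply/allpairsPdep.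
by exists i, p; rewrite mem_iota (nth_map (V 0%N)).
Qed.

(** Against a variable, the difference of the numbers detects by injectivity. Against an
    application, either the head functions differ in value, or some argument differs and is treated
    at an extended position. *)
Lemma detects_at x t p st0 : (x < n)%N -> all (ltn^~ n) (occurrences t) ->
  (forall q, q \in positions t -> p ++ q \in P) ->
  sub_at p (val st0 x) <> Some (subst (nth (V 0%N) st0) t) ->
  detects (fun st => sub_at p (val st x) = Some (subst (nth (V 0%N) st) t)) st0.
Proof.
move=> ltx; elim/term_in_ind: t p => [y|f ts IH] p vars posP ne.
  have pP : p \in P by rewrite -[p]cats0 posP // inE.
  move: vars; rewrite /= andbT => lty.
  exists (fun st => num_at S p (val st x) - num_at S [::] (val st y)).
    apply: spanned_sub.
      exact: (@coord_val (num_at S p) x (ltnW ltx) (spanned_in (basic_num _ pP))).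
    exact: (@coord_val (num_at S [::]) y (ltnW lty) (spanned_in (basic_num _ P_nil))).
  split=> [|st]; last by rewrite /num_at /= => ->; rewrite subrr.
  move=> /eqP; rewrite subr_eq0 /num_at /=.
  case E: (sub_at p _) ne => [u|] ne.
    by rewrite eqr_nat => /eqP /num_inj Eu; apply: ne; rewrite Eu.
  by rewrite eq_sym pnatr_eq0 -leqn0 leqNgt num_gt0.
have pP : p \in P by rewrite -[p]cats0 posP // inE.
pose k := (pickle (f, size ts)).+1.
have headE st : sub_at p (val st x) = Some (subst (nth (V 0%N) st) (App f ts)) ->
    head_at p (val st x) = k%:R.
  by rewrite /head_at => ->; rewrite /= size_map.
case: (eqVneq (head_at p (val st0 x)) k%:R) => [hd|nhd]; last first.
  exists (fun st => head_at p (val st x) - k%:R).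
    apply: spanned_sub; last exact: coord_const.
    exact: (@coord_val (head_at p) x (ltnW ltx) (spanned_in (basic_head _ pP))).
  split=> [/eqP|st /headE ->]; last by rewrite subrr.
  by rewrite subr_eq0 (negPf nhd).
have [us [Eus sz]] : exists us, sub_at p (val st0 x) = Some (App f us) /\ size us = size ts.
  move: hd; rewrite /head_at; case: (sub_at p _) => [[y|g us]|].
  - by move=> /eqP; rewrite eq_sym pnatr_eq0.
  - move=> /eqP; rewrite eqr_nat eqSS => /eqP /(pcan_inj pickleK) [-> sz].
    by exists us.
  by move=> /eqP; rewrite eq_sym pnatr_eq0.
have [i lti nei] : exists2 i, (i < size ts)%N &
    nth (V 0%N) us i <> subst (nth (V 0%N) st0) (nth (V 0%N) ts i).
  apply: NNPP => H; apply: ne; rewrite Eus /=; congr (Some (App f _)).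
  apply: (@eq_from_nth _ (V 0%N)); rewrite ?size_map // sz => i lti.
  rewrite (nth_map (V 0%N)) //; apply: NNPP => nei; apply: H; by exists i.
have tin := mem_nth (V 0%N) lti.
apply: (@detects_sub (fun st => sub_at (rcons p i) (val st x) =
    Some (subst (nth (V 0%N) st) (nth (V 0%N) ts i)))).
  move=> st; rewrite sub_at_rcons => -> /=.
  by rewrite onth_map (onthE _ _) (nth_map (V 0%N)).
apply: IH => //.
- apply/allP => y yin; apply: (allP vars) => /=; apply/flattenP.
  by exists (occurrences (nth (V 0%N) ts i)); rewrite ?map_f.
- by move=> q qin; rewrite cat_rcons; apply: posP; apply: positions_arg.
by rewrite sub_at_rcons Eus /= => /(onth_nth (V 0%N)) E; apply: nei.
Qed.

(** Descend through both sides in parallel, into arguments whose values differ, until one side is a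
    variable or the heads or numbers of arguments clash. *)
Lemma detects_eq s t st0 :
  all (ltn^~ n) (occurrences s) -> all (ltn^~ n) (occurrences t) ->
  {subset positions s <= P} -> {subset positions t <= P} ->
  subst (nth (V 0%N) st0) s <> subst (nth (V 0%N) st0) t ->
  detects (fun st => subst (nth (V 0%N) st) s = subst (nth (V 0%N) st) t) st0.
Proof.
have Pw p q : p ++ q \in P -> q \in P by elim: p => //= i p IH /P_behead.
elim/term_in_ind: s t => [x|f ss IH] t vs vt Ps Pt ne.
  apply: (@detects_sub (fun st => sub_at [::] (val st x) = Some (subst (nth (V 0%N) st) t))).
    by move=> st /= ->.
  apply: detects_at => //; first by move: vs; rewrite /= andbT.
  by move=> [] /ne.
case: t vt Pt ne => [x|g ts] vt Pt ne.
  apply: (@detects_sub (fun st => sub_at [::] (val st x) = Some (subst (nth (V 0%N) st) (App f ss)))).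
    by move=> st /= ->.
  apply: detects_at => //; first by move: vt; rewrite /= andbT.
  by move=> [] /esym /ne.
case: (eqVneq f g) => [Efg|nfg]; last first.
  by apply: detects_false => st [E]; rewrite E eqxx in nfg.
case: (eqVneq (size ss) (size ts)) => [sz|nsz]; last first.
  by apply: detects_false => st [_ /(congr1 size)]; rewrite !size_map => E; rewrite E eqxx in nsz.
have [i lti nei] : exists2 i, (i < size ts)%N &
    subst (nth (V 0%N) st0) (nth (V 0%N) ss i) <> subst (nth (V 0%N) st0) (nth (V 0%N) ts i).
  apply: NNPP => H; apply: ne; rewrite /= Efg; congr (App g _).
  apply: (@eq_from_nth _ (V 0%N)); rewrite ?size_map // sz => i lti.
  rewrite !(nth_map (V 0%N)) ?sz //; apply: NNPP => nei; apply: H; by exists i.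
have sin : nth (V 0%N) ss i \in ss by rewrite mem_nth ?sz.
have tin := mem_nth (V 0%N) lti.
apply: (@detects_sub (fun st => subst (nth (V 0%N) st) (nth (V 0%N) ss i) =
    subst (nth (V 0%N) st) (nth (V 0%N) ts i))).
  move=> st /= [_ /(congr1 (fun l => nth (V 0%N) l i))].
  by rewrite !(nth_map (V 0%N)) ?sz.
apply: IH => //.
- apply/allP => y yin; apply: (allP vs) => /=; apply/flattenP.
  by exists (occurrences (nth (V 0%N) ss i)); rewrite ?map_f.
- apply/allP => y yin; apply: (allP vt) => /=; apply/flattenP.
  by exists (occurrences (nth (V 0%N) ts i)); rewrite ?map_f.
- by move=> q qin; apply: (P_behead (i := i)); apply: Ps; apply: positions_arg; rewrite ?sz.
by move=> q qin; apply: (P_behead (i := i)); apply: Pt; apply: positions_arg.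
Qed.
End Representation.

(** * Symbolic executions *)

Lemma all_In T (a : pred T) s x : all a s -> List.In x s -> a x.
Proof. by elim: s => //= y s IH /andP[ay /IH H] [<-|/H]. Qed.

Lemma onth_In T (s : seq T) i x : onth s i = Some x -> List.In x s.
Proof. by elim: s i => [|y s IH] [|i] //= => [[->]|/IH]; [left|right]. Qed.

Lemma In_flatten_map (T : Type) (U : eqType) (f : T -> seq U) s y :
  y \in flatten (map f s) <-> exists2 x, List.In x s & y \in f x.
Proof.
elim: s => [|x s IH] /=; first by split=> // -[].
rewrite mem_cat; split=> [/orP[yx|/IH[z zs yz]]|[z [<-->|zs yz]]] //.
- by exists x => //; left.
- by exists z => //; right.
by apply/orP; right; apply/IH; exists z.
Qed.

Section Symbolic.
Variables (Omega : countType) (ar : Omega -> nat) (p : program Omega).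
Notation V := (Var Omega).
Notation n := (nvars p).
Notation val st := (nth (V 0) st).
Implicit Types (st : store Omega) (u v w : point) (stk : seq point).

Definition store0 : store Omega := map V (iota 0 n).

(* Values are terms whose variables are atoms: [Var x] with [x < n] stands for
   the unknown initial value of [x], and a havoc may produce any atom. *)
Inductive sexec : point -> seq point -> store Omega -> Prop :=
  | sexec_init v : v.1 = main p -> is_start p v -> sexec v [::] store0
  | sexec_set u v stk st x t : sexec u stk st -> has_edge p u (Assign x t) v ->
      sexec v stk (run1 st (OSet x t))
  | sexec_atom u v stk st x a : sexec u stk st -> has_edge p u (Havoc Omega x) v ->
      sexec v stk (run1 st (OAtom Omega x a))
  | sexec_call u v w stk st q : sexec u stk st -> has_edge p u (Call Omega q) v ->
      w.1 = q -> is_start p w -> sexec w (v :: stk) st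
  | sexec_return w v stk st : sexec w (v :: stk) st -> is_return p w ->
      sexec v stk st.

Hypothesis wf_p : wf_program ar p.

Lemma wf_proc q P : onth (procs p) q = Some P ->
  wf_procedure ar n (size (procs p)) P.
Proof.
by have /andP[_ wfs] := wf_p; move=> E; exact: all_In wfs (onth_In E).
Qed.

Lemma edge_wf u l v : has_edge p u l v ->
  wf_label ar n (size (procs p)) l.
Proof.
case=> _ [P /wf_proc /and3P[_ _ we] ein].
by have /and3P[] := all_In we ein.
Qed.

Lemma wf_term_vars k t : wf_term ar k t -> all (ltn^~ k) (occurrences t).
Proof.
elim/term_in_ind: t => [x|f ts IH] /=; first by rewrite andbT.
case/andP=> _ /allP wts; apply/allP => x /flattenP[l /mapP[t tin ->]].
exact: (allP (IH t tin (wts t tin))).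
Qed.

Lemma subst_wf (s1 s2 : state Omega) k t : wf_term ar k t ->
  (forall x, x < k -> s1 x = s2 x) -> subst s1 t = subst s2 t.
Proof.
by move=> /wf_term_vars /allP vs E; apply: subst_eq_in => x /vs; apply: E.
Qed.

Lemma ground_wf k t : ground ar t -> wf_term ar k t.
Proof.
rewrite /ground; elim/term_in_ind: t => [x|f ts IH] //= /andP[-> /allP wts].
by apply/allP => t tin; apply: IH (wts t tin).
Qed.

Lemma subst_ground (s : state Omega) k t : wf_term ar k t ->
  (forall x, x < k -> ground ar (s x)) -> ground ar (subst s t).
Proof.
move=> wt gs; rewrite /ground; elim/term_in_ind: t wt => [x|f ts IH] /=; first exact: gs.
case/andP=> /eqP sz /allP wts; rewrite size_map sz eqxx /=.
by apply/allP => _ /mapP[t tin ->]; apply: IH (wts t tin).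
Qed.

Lemma sexec_size v stk st : sexec v stk st -> size st = n.
Proof.
have sz st' x y : size st' = n -> x < n -> size (set_nth (V 0) st' x y) = n.
  by move=> E lt; rewrite size_set_nth E; apply/maxn_idPr.
elim=> {v stk st} [v _ _|u v stk st x t _ IH E|u v stk st x a _ IH E| |] //.
- by rewrite size_map size_iota.
- by apply: sz => //; have /andP[] := edge_wf E.
by apply: sz => //; have := edge_wf E.
Qed.

Lemma exec_is_state v stk sigma : exec ar p v stk sigma -> is_state ar n sigma.
Proof.
elim=> {v stk sigma} // [u v stk sg x t _ IH ed|u v stk sg x g _ IH ed gg] y lty;
  rewrite /update; case: eqP => _ //; try exact: IH.
have /andP[_ wt] := edge_wf ed; exact: subst_ground wt IH.
Qed.

(** [B] bounds the atoms in use, which makes a fresh atom available for the next havoc; hence a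
    single [theta] explains all values. *)
Lemma exec_symbolic v stk sigma : exec ar p v stk sigma ->
  exists st (theta : state Omega) B, [/\ sexec v stk st,
    forall x, x < n -> sigma x = subst theta (val st x) &
    forall x, x < n -> all (ltn^~ B) (occurrences (val st x))].
Proof.
elim=> {v stk sigma}.
- move=> v sigma vm sv _; exists store0, sigma, n; split=> [|x lt|x lt].
  + exact: sexec_init.
  + by rewrite (nth_map 0) ?size_iota // nth_iota.
  + by rewrite (nth_map 0) ?size_iota // nth_iota //= andbT.
- move=> u v stk sigma x t _ [st [theta [B [sx E vs]]]] ed.
  exists (run1 st (OSet x t)), theta, B; have /andP[ltx wt] := edge_wf ed.
  split=> [|y lty|y lty]; first exact: sexec_set ed.
    rewrite nth_set_nth /update /=; case: eqP => _; last exact: E.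
    by rewrite subst_comp; apply: subst_wf wt _ => z /E.
  rewrite nth_set_nth /=; case: eqP => _; last exact: vs.
  have /allP := wf_term_vars wt; elim/term_in_ind: (t) => [z|f ts IH] /= H.
    by apply: vs; apply: H; rewrite inE.
  apply/allP => z /flattenP[l /mapP[_ /mapP[s sin ->] ->] zin].
  apply: (allP (IH s sin _) z zin) => y' yin; apply: H; apply/flattenP.
  by exists (occurrences s) => //; apply: map_f.
- move=> u v stk sigma x g _ [st [theta [B [sx E vs]]]] ed gg.
  (* Redefining [theta] at the fresh atom [B] does not disturb the values already explained. *)
  exists (run1 st (OAtom Omega x B)), (update theta B g), B.+1.
  have ltx := edge_wf ed.
  split=> [|y lty|y lty]; first exact: sexec_atom ed.
    rewrite nth_set_nth {1}/update /=; case: eqP => _; first by rewrite /= /update eqxx.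
    rewrite E //; apply: subst_eq_in => z /(allP (vs y lty)) ltz.
    by rewrite /update; case: eqP ltz => //= ->; rewrite ltnn.
  rewrite nth_set_nth /=; case: eqP => _ /=; first by rewrite ltnSn.
  by apply: sub_all (vs y lty) => z /ltnW.
- move=> u v w stk sigma q _ [st [theta [B [sx E vs]]]] ed wq sw.
  by exists st, theta, B; split=> //; apply: sexec_call ed wq sw.
move=> w v stk sigma _ [st [theta [B [sx E vs]]]] rw.
by exists st, theta, B; split=> //; apply: sexec_return rw.
Qed.

Lemma sexec_ground v stk st (theta : state Omega) :
  (forall a, ground ar (theta a)) -> sexec v stk st ->
  exists2 sigma, exec ar p v stk sigma & forall x, x < n -> sigma x = subst theta (val st x).
Proof.
move=> gt; elim=> {v stk st}.
- move=> v vm sv; exists theta; first by apply: exec_init => // x _; apply: gt.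
  by move=> x lt; rewrite (nth_map 0) ?size_iota // nth_iota.
- move=> u v stk st x t _ [sigma ex E] ed.
  exists (update sigma x (subst sigma t)); first exact: exec_assign ed.
  move=> y lty; rewrite nth_set_nth /update /=; case: eqP => _; last exact: E.
  have /andP[ltx wt] := edge_wf ed.
  by rewrite subst_comp; apply: subst_wf wt _ => z /E.
- move=> u v stk st x a _ [sigma ex E] ed.
  exists (update sigma x (theta a)); first exact: exec_havoc ed _.
  by move=> y lty; rewrite nth_set_nth /update /=; case: eqP => _; last exact: E.
- move=> u v w stk st q _ [sigma ex E] ed wq sw.
  by exists sigma => //; apply: exec_call ed wq sw.
move=> w v stk st _ [sigma ex E] rw.
by exists sigma => //; apply: exec_return rw.
Qed.

(** Distinct variables are separated by sending one to [d] and the rest to [c]. A variable against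
    an application with variables fails by size, and against a ground application because that would
    equal both [c] and [d]. *)
Lemma separate (c d s t : term Omega) : ground ar c -> ground ar d -> c <> d ->
  (forall theta : state Omega, (forall a, ground ar (theta a)) ->
     subst theta s = subst theta t) -> s = t.
Proof.
move=> gc gd cd; elim/term_in_ind: s t => [x|f ss IH] t H.
  case: t H => [y|g ts] H.
    case: (eqVneq x y) => [->//|xy].
    have g1 a : ground ar (update (fun=> c) x d a) by rewrite /update; case: eqP.
    by have /= := H _ g1; rewrite /update eqxx eq_sym (negPf xy) => /esym.
  case ht: (hole (App g ts)); last first.
    have /= := H (fun=> c) (fun=> gc); have /= := H (fun=> d) (fun=> gd).
    move=> Ed Ec; case: cd.
    by rewrite Ec Ed -!/(subst _ (App g ts)) !nohole_subst ?ht.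
  by have [] := fill_loop ht (esym (H (fun=> c) (fun=> gc))).
case: t H => [y|g ts] H.
  case ht: (hole (App f ss)); last first.
    have /= := H (fun=> c) (fun=> gc); have /= := H (fun=> d) (fun=> gd).
    move=> Ed Ec; case: cd.
    by rewrite -Ec -Ed -!/(subst _ (App f ss)) !nohole_subst ?ht.
  by have [] := fill_loop ht (H (fun=> c) (fun=> gc)).
have [Ef] := H (fun=> c) (fun=> gc).
move/(congr1 size); rewrite !size_map => sz; rewrite Ef; congr App.
apply: (@eq_from_nth _ (V 0)) => // i lti; apply: IH; first exact: mem_nth.
move=> theta gt; have [_ /(congr1 (fun l => nth (V 0) l i))] := H theta gt.
by rewrite !(nth_map (V 0)) // -sz.
Qed.

Lemma valid_symbolic (c d : term Omega) v (e : equality Omega) :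
  ground ar c -> ground ar d -> c <> d -> wf_equality ar n e ->
  (valid ar p v e <-> forall stk st, sexec v stk st -> holds (val st) e).
Proof.
move=> gc gd cd /andP[w1 w2]; split=> [va stk st sx|H stk sigma].
  apply: (separate gc gd cd) => theta gt.
  have [sigma ex E] := sexec_ground gt sx.
  have := va _ _ ex; rewrite /holds !subst_comp.
  by rewrite (subst_wf w1 E) (subst_wf w2 E).
move=> /exec_symbolic[st [theta [B [sx E _]]]]; have := H _ _ sx.
rewrite /holds (subst_wf w1 E) (subst_wf w2 E) -!subst_comp; by move->.
Qed.

Definition config : Type := (point * seq point * store Omega)%type.

Definition no_proc : procedure Omega := Procedure 0 0 0 [::].
Definition proc_of q := nth no_proc (procs p) q.

(** A havoc branches only over the atoms 0 and 1, so each configuration has finitely many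
    successors; [cl_atom] later shows that these two suffice. *)
Definition succ_edge (c : config) (e : nat * label Omega * nat) : seq config :=
  let: (u, stk, st) := c in
  if e.1.1 == u.2 then
    let v := (u.1, e.2) in
    match e.1.2 with
    | Assign x t => [:: (v, stk, run1 st (OSet x t))]
    | Havoc x => [:: (v, stk, run1 st (OAtom Omega x 0)); (v, stk, run1 st (OAtom Omega x 1))]
    | Call q => [:: ((q, start (proc_of q)), v :: stk, st)]
    end
  else [::].

Definition succ_return (c : config) : seq config :=
  let: (u, stk, st) := c in
  if u.2 == return_ (proc_of u.1) then
    if stk is r :: stk' then [:: (r, stk', st)] else [::]
  else [::].

Definition succ (c : config) : seq config :=
  flatten (map (succ_edge c) (edges (proc_of c.1.1.1))) ++ succ_return c.

(** Keeping the old configurations makes [explore] cumulative, hence monotone in the number of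
    rounds. *)
Definition extend (cs : seq config) := cs ++ flatten (map succ cs).
Definition explore k cs := iter k extend cs.

Definition config0 : config := ((main p, start (proc_of (main p))), [::], store0).

Lemma onth_proc q P : onth (procs p) q = Some P -> proc_of q = P.
Proof. by rewrite /proc_of; elim: (procs p) q => [|Q Ps IH] [|q] //= => [[]|/IH]. Qed.

Lemma onth_lt q : q < size (procs p) -> onth (procs p) q = Some (proc_of q).
Proof. by rewrite /proc_of; elim: (procs p) q => [|Q Ps IH] [|q] //=; apply: IH. Qed.

Lemma lt_onth q P : onth (procs p) q = Some P -> q < size (procs p).
Proof. by elim: (procs p) q => [|Q Ps IH] [|q] //=; apply: IH. Qed.

Lemma sexec_range v stk st : sexec v stk st ->
  all (fun u : point => u.1 < size (procs p)) (v :: stk).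
Proof.
elim=> {v stk st} /=.
- by move=> v _ [P /lt_onth ->].
- by move=> u v stk st x t _ /andP[lt ->] [<- _]; rewrite lt.
- by move=> u v stk st x t _ /andP[lt ->] [<- _]; rewrite lt.
- by move=> u v w stk st q _ /andP[lt ->] [<- _] _ [P /lt_onth ->]; rewrite lt.
by move=> w v stk st _ /andP[_ ->].
Qed.

Lemma succ_sexec c c' : sexec c.1.1 c.1.2 c.2 -> c' \in succ c ->
  sexec c'.1.1 c'.1.2 c'.2.
Proof.
case: c => [[u stk] st] /= sx; have /andP[ltu _] := sexec_range sx.
have Pu := onth_lt ltu.
rewrite mem_cat => /orP[/In_flatten_map[[[a l] b] ein] /=|].
  case: eqP => // Ea; rewrite Ea in ein.
  have ed : has_edge p u l (u.1, b) by split=> //; exists (proc_of u.1).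
  case: l ed {ein} => [x t|x|q] ed; rewrite !inE.
  - by move=> /eqP-> /=; apply: sexec_set ed.
  - by case/orP=> /eqP-> /=; apply: sexec_atom ed.
  move=> /eqP-> /=; apply: (sexec_call sx ed) => //.
  by exists (proc_of q) => //; apply/onth_lt/(edge_wf ed).
rewrite /=; case: eqP => // Er; case: stk sx => // r stk sx.
rewrite inE => /eqP-> /=; apply: sexec_return sx _.
by exists (proc_of u.1).
Qed.

Lemma explore_sexec k c : c \in explore k [:: config0] -> sexec c.1.1 c.1.2 c.2.
Proof.
elim: k c => [|k IH] c.
  rewrite inE => /eqP-> /=; apply: sexec_init => //.
  by exists (proc_of (main p)) => //; apply: onth_lt; case/andP: wf_p.
rewrite /= mem_cat => /orP[/IH//|/flattenP[l /mapP[c' c'in ->]]].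
exact/succ_sexec/IH.
Qed.

Lemma explore_sub k cs cs' : {subset cs <= cs'} -> {subset explore k cs <= explore k cs'}.
Proof.
move=> sub; elim: k => //= k IH c; rewrite !mem_cat => /orP[/IH->//|].
case/flattenP=> l /mapP[c' c'in ->] cin; apply/orP; right.
by apply/flattenP; exists (succ c') => //; apply/map_f/IH.
Qed.

Lemma explore_le k k' cs : k <= k' -> {subset explore k cs <= explore k' cs}.
Proof.
move=> /subnKC <-; elim: (k' - k) => [|d IH] c; rewrite ?addn0 // addnS => /IH H.
by rewrite /= mem_cat H.
Qed.

Lemma explore_trans k k' c c' c'' : c' \in explore k [:: c] ->
  c'' \in explore k' [:: c'] -> c'' \in explore (k + k') [:: c].
Proof.
move=> H H'; rewrite /explore addnC iterD.
by apply: explore_sub H' => x; rewrite inE => /eqP->.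
Qed.

Lemma explore_succ c c' : c' \in succ c -> c' \in explore 1 [:: c].
Proof. by move=> H; rewrite /= /extend mem_cat /= cats0 H orbT. Qed.

Lemma edge_succ u stk st l v c' : has_edge p u l v ->
  c' \in succ_edge (u, stk, st) (u.2, l, v.2) -> c' \in succ (u, stk, st).
Proof.
move=> [_ [P /onth_proc EP ein]] H; rewrite mem_cat; apply/orP; left.
by apply/In_flatten_map; exists (u.2, l, v.2) => //=; rewrite EP.
Qed.

End Symbolic.

(** * Bounded exploration is a complete test *)

Arguments explore : simpl never.

Section Derivations.
Variables (Omega : countType) (ar : Omega -> nat) (p : program Omega).
Hypothesis wf_p : wf_program ar p.
Notation V := (Var Omega).
Notation n := (nvars p).
Notation val st := (nth (V 0) st).
Notation word := (seq (op Omega)).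
Notation store0 := (store0 p).
Notation config0 := (config0 p).
Implicit Types (st : store Omega) (u v : point) (stk : seq point) (w : word).

(* [(false, v)] produces the effects of the same-level paths from the start of
   the procedure of [v] to [v], and [(true, (q, 0))] the effects of the paths
   from the start of the program to the start of [q]. *)
Inductive produces (A : pred nat) (W : bool * point -> word -> Prop) :
    bool * point -> word -> Prop :=
  | prod_old X w : W X w -> produces A W X w
  | prod_start v : is_start p v -> produces A W (false, v) [::]
  | prod_set u v x t w : W (false, u) w -> has_edge p u (Assign x t) v ->
      produces A W (false, v) (w ++ [:: OSet x t])
  | prod_atom u v x a w : W (false, u) w -> has_edge p u (Havoc Omega x) v -> A a ->
      produces A W (false, v) (w ++ [:: OAtom Omega x a])
  | prod_call u v q r w w' : W (false, u) w -> has_edge p u (Call Omega q) v ->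
      r.1 = q -> is_return p r -> W (false, r) w' ->
      produces A W (false, v) (w ++ w')
  | prod_main : produces A W (true, (main p, 0)) [::]
  | prod_enter u v q w w' : W (true, (u.1, 0)) w -> W (false, u) w' ->
      has_edge p u (Call Omega q) v -> produces A W (true, (q, 0)) (w ++ w').

Fixpoint derives (A : pred nat) k : bool * point -> word -> Prop :=
  if k is k'.+1 then produces A (derives A k') else fun _ _ => False.

Definition any_atom : pred nat := predT.
Definition two_atoms : pred nat := fun a => a < 2.

Lemma derives_le A k k' X w : k <= k' -> derives A k X w -> derives A k' X w.
Proof.
by move=> /subnKC <-; elim: (k' - k) => [|d IH]; rewrite ?addn0 // addnS => /IH; apply: prod_old.
Qed.

Definition derivable X w := exists k, derives any_atom k X w.

Lemma derivable_produces X w : produces any_atom derivable X w -> derivable X w.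
Proof.
have two k k' Y y Z z : derives any_atom k Y y -> derives any_atom k' Z z ->
    derives any_atom (maxn k k') Y y /\ derives any_atom (maxn k k') Z z.
  by move=> Hy Hz; split; [apply: derives_le Hy|apply: derives_le Hz]; lia.
case.
- by [].
- by move=> v sv; exists 1; apply: prod_start.
- by move=> u v x t {}w [k Ww] ed; exists k.+1; apply: prod_set Ww ed.
- by move=> u v x a {}w [k Ww] ed; exists k.+1; apply: prod_atom Ww ed _.
- move=> u v q r {}w w' [k Ww] ed rq ret [k' Ww'].
  have [D D'] := two _ _ _ _ _ _ Ww Ww'.
  by exists (maxn k k').+1; apply: prod_call D ed rq ret D'.
- by exists 1; apply: prod_main.
move=> u v q {}w w' [k Ww] [k' Ww'] ed; have [D D'] := two _ _ _ _ _ _ Ww Ww'.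
by exists (maxn k k').+1; apply: prod_enter D D' ed.
Qed.

(** Factors the word leading to the start of [q] along the pending calls, so that a return can
    recover the caller's entry word [w1] and its same-level word [w2]. *)
Fixpoint stack_ok q stk w : Prop :=
  if stk is r :: stk' then exists u w1 w2,
      [/\ derivable (true, (u.1, 0)) w1, derivable (false, u) w2,
          has_edge p u (Call Omega q) r, w = w1 ++ w2 & stack_ok u.1 stk' w1]
  else q = main p /\ w = [::].

Lemma stack_ok_derivable q stk w : stack_ok q stk w -> derivable (true, (q, 0)) w.
Proof.
case: stk => [[-> ->]|r stk [u [w1 [w2 [d1 d2 ed -> _]]]]].
  exact/derivable_produces/prod_main.
by apply: derivable_produces; apply: prod_enter d1 d2 ed.
Qed.

Lemma sexec_derivable v stk st : sexec p v stk st -> exists w1 w2,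
  [/\ stack_ok v.1 stk w1, derivable (false, v) w2 & st = run store0 (w1 ++ w2)].
Proof.
elim=> {v stk st}.
- move=> v vm sv; exists [::], [::]; split=> //.
  exact/derivable_produces/prod_start.
- move=> u v stk st x t _ [w1 [w2 [ok d ->]]] ed; exists w1, (w2 ++ [:: OSet x t]).
  split; last by rewrite catA [RHS]run_cat.
    by have [<- _] := ed.
  by apply: derivable_produces; apply: prod_set d ed.
- move=> u v stk st x a _ [w1 [w2 [ok d ->]]] ed; exists w1, (w2 ++ [:: OAtom Omega x a]).
  split; last by rewrite catA [RHS]run_cat.
    by have [<- _] := ed.
  by apply: derivable_produces; apply: prod_atom d ed _.
- move=> u v w stk st q _ [w1 [w2 [ok d ->]]] ed wq sw; exists (w1 ++ w2), [::].
  split; last by rewrite cats0.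
    exists u, w1, w2; split=> //; last by rewrite wq.
    exact: stack_ok_derivable ok.
  exact/derivable_produces/prod_start.
move=> w v stk st _ [w1 [w2 [[u [w3 [w4 [d3 d4 ed -> ok]]]] d ->]]] rw.
exists w3, (w4 ++ w2); split; last by rewrite catA.
  by have [<- _] := ed.
by apply: derivable_produces; apply: (prod_call _ d4 ed erefl rw d).
Qed.

(** The worst production is a call: two subderivations, one step to enter and one to return. *)
Fixpoint run_length k := if k is k'.+1 then (run_length k').*2.+2 else 0.

Lemma run_lengthE k : (run_length k).+2 = 2 ^ k.+1.
Proof. by elim: k => //= k IH; rewrite expnS -IH; lia. Qed.

(** Stack and store are arbitrary because a same-level path is replayed below every caller. *)
Lemma derives_explore_same k v w : derives two_atoms k (false, v) w ->
  forall stk st, (v, stk, run st w) \in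
    explore p (run_length k) [:: ((v.1, start (proc_of p v.1)), stk, st)].
Proof.
elim: k v w => //= k IH v w; move E: (false, v) => X H; case: H E => {X w} //.
- move=> X w Ww E stk st; rewrite -E in Ww.
  by apply: (explore_le _ (IH _ _ Ww stk st)); lia.
- move=> u [P /onth_proc E Es] [->] stk st.
  apply: (@explore_le _ _ 0) => //; rewrite inE; case: u E Es => a b /= -> ->.
  by [].
- move=> u v' x t w Ww ed [->] stk st; have [E _] := ed.
  apply: (@explore_le _ _ (run_length k + 1)); first by lia.
  apply: explore_trans; first by rewrite -E; apply: IH Ww stk st.
  apply: explore_succ; apply: (edge_succ ed) => /=.
  by rewrite eqxx run_cat inE E -surjective_pairing.
- move=> u v' x a w Ww ed A [->] stk st; have [E _] := ed.
  apply: (@explore_le _ _ (run_length k + 1)); first by lia.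
  apply: explore_trans; first by rewrite -E; apply: IH Ww stk st.
  apply: explore_succ; apply: (edge_succ ed) => /=.
  rewrite eqxx run_cat !inE E -surjective_pairing.
  by case: a A => [|[|]]; rewrite ?eqxx ?orbT.
move=> u v' q r w w' Ww ed rq ret Ww' [->] stk st; have [E _] := ed.
apply: (@explore_le _ _ (run_length k + 1 + run_length k + 1)); first by lia.
apply: (explore_trans (c' := (r, v' :: stk, run st (w ++ w')))); last first.
  apply: explore_succ; rewrite /succ mem_cat; apply/orP; right.
  have [P /onth_proc EP Er] := ret.
  by rewrite /succ_return EP Er eqxx inE.
rewrite run_cat; apply: explore_trans; last exact: IH Ww' _ _.
apply: explore_trans; first by rewrite -E; apply: IH Ww stk st.
apply: explore_succ; apply: (edge_succ ed) => /=.
by rewrite eqxx inE rq E -surjective_pairing.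
Qed.

Lemma derives_explore k q w : derives two_atoms k (true, (q, 0)) w ->
  exists stk, ((q, start (proc_of p q)), stk, run store0 w) \in
    explore p (run_length k) [:: config0].
Proof.
elim: k q w => //= k IH q w; move E: (true, _) => X H; case: H E => {X w} //.
- move=> X w Ww E; rewrite -E in Ww; have [stk H] := IH _ _ Ww.
  by exists stk; apply: (explore_le _ H); lia.
- by move=> [->]; exists [::]; apply: (@explore_le _ _ 0) => //; rewrite inE.
move=> u v q' w w' Ww Ww' ed [->]; have [stk H] := IH _ _ Ww.
exists (v :: stk); apply: (@explore_le _ _ (run_length k + run_length k + 1)); first by lia.
apply: explore_trans; first by apply: explore_trans H (derives_explore_same Ww' _ _).
apply: explore_succ; apply: (edge_succ ed) => /=.
by have [E _] := ed; rewrite eqxx inE run_cat E -surjective_pairing.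
Qed.

(** * Stabilization of the spans and the bounded test *)

Section Bound.
Variables (S : seq (term Omega)) (P : seq (seq nat)) (B : nat).
Hypothesis S_nohole : forall g, g \in S -> ~~ hole g.
Hypothesis S_sub : forall g s, g \in S -> s \in subterms g -> s \in S.
Hypothesis P_nil : [::] \in P.
Hypothesis P_behead : forall i l, i :: l \in P -> l \in P.
Hypothesis rhs1 : rhs_at_most_one_var p.
Hypothesis S_rhs : forall u x t v, has_edge p u (Assign x t) v -> small S t.
Hypothesis B_procs : size (procs p) <= B.
Hypothesis B_points : forall q Q, onth (procs p) q = Some Q -> npoints Q <= B.

Lemma derives_wf A k X w : derives A k X w ->
  all (wf_op n S) w && ((X.2.1 < B) && (X.2.2 < B)).
Proof.
have edB u l v : has_edge p u l v -> (v.1 < B) && (v.2 < B).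
  move=> [<- [Q EQ ein]]; have := lt_onth EQ; have := B_points EQ.
  have /and3P[_ _ we] := wf_proc wf_p EQ.
  have /and3P[_ _ /=] := all_In we ein; lia.
have lt0 q : q < size (procs p) -> (q < B) && (0 < B) by move: B_procs; lia.
elim: k X w => //= k IH X w; case=> {X w} //=.
- move=> v [Q EQ ->]; have := lt_onth EQ; have := B_points EQ.
  by have /and3P[+ _ _] := wf_proc wf_p EQ; lia.
- move=> u v x t w /IH /andP[ww _] ed; rewrite all_cat ww (edB _ _ _ ed) /= !andbT.
  have /andP[-> wt] := edge_wf wf_p ed; rewrite (S_rhs ed) (wf_term_vars wt) /= !andbT.
  have [_ [Q EQ ein]] := ed.
  exact: (all_In (all_In rhs1 (onth_In EQ)) ein).
- move=> u v x a w /IH /andP[ww _] ed _; rewrite all_cat ww (edB _ _ _ ed) /= !andbT.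
  exact: (edge_wf wf_p ed).
- by move=> u v q r w w' /IH /andP[ww _] ed _ _ /IH /andP[ww' _]; rewrite all_cat ww ww' (edB _ _ _ ed).
- by apply: lt0; case/andP: wf_p.
move=> u v q w w' /IH /andP[ww _] /IH /andP[ww' _] ed.
by rewrite all_cat ww ww' lt0 //; apply: (edge_wf wf_p ed).
Qed.

Notation N := (bool * ('I_B * 'I_B))%type.
Notation dim := (dim n S P).
Notation cl := (cl (op_mx n S P)).
Notation height := (2 * (B * B) * (dim * dim)).

Lemma derives_stable : exists2 k, k <= height &
  forall X w, derives two_atoms k.+1 X w -> cl (derives two_atoms k X) w.
Proof.
pose pt (X : N) : bool * point := (X.1, (nat_of_ord X.2.1, nat_of_ord X.2.2)).
have [|k lek H] := @chain_stable _ _ (op_mx n S P) N (fun k X => derives two_atoms k (pt X)).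
  by move=> k X w; apply: prod_old.
exists k; first by move: lek; rewrite !card_prod card_bool !card_ord.
move=> [b [x y]] w Dw; have /andP[_ /andP[/= ltx lty]] := derives_wf Dw.
exact: (H (b, (Ordinal ltx, Ordinal lty))).
Qed.

(** Induction on an arbitrary derivation. Each production carries over to spans by [cl_cat], an
    arbitrary atom being replaced by the two atoms through [cl_atom]; this lands in level [k.+1],
    and stability leads back to level [k]. *)
Lemma derivable_cl : exists2 k, k <= height &
  forall X w, derivable X w -> cl (derives two_atoms k X) w.
Proof.
have [k lek stable] := derives_stable; exists k => // X w [k' D].
have up Y y : cl (derives two_atoms k.+1 Y) y -> cl (derives two_atoms k Y) y.
  by apply: cl_cl; apply: stable.
elim: k' X w D => //= k' IH X w; case=> {X w}.
- by move=> X w /IH.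
- by move=> v sv; apply/up/cl_in/prod_start.
- move=> u v x t w /IH clw ed; apply: up.
  have clx := @cl_in _ _ (op_mx n S P) (eq [:: OSet x t]) _ erefl.
  apply: (cl_cat _ clw clx) => y _ Wy <-.
  exact: prod_set Wy ed.
- move=> u v x a w /IH clw ed _; apply: up.
  have clx : cl (fun w => exists2 a, two_atoms a & w = [:: OAtom Omega x a])
      [:: OAtom Omega x a] by apply: cl_atom; [exists 0 | exists 1].
  apply: (cl_cat _ clw clx).
  by move=> y _ Wy [a' A ->]; apply: prod_atom Wy ed A.
- move=> u v q r w w' /IH clw ed rq ret /IH clw'; apply: up.
  by apply: (cl_cat _ clw clw') => y z Wy; apply: prod_call Wy ed rq ret.
- exact/up/cl_in/prod_main.
move=> u v q w w' /IH clw /IH clw' ed; apply: up.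
by apply: (cl_cat _ clw clw') => y z Wy Wz; apply: prod_enter Wy Wz ed.
Qed.

Import GRing.Theory.

Lemma bounded_test v (e : equality Omega) T :
  wf_equality ar n e ->
  {subset positions e.1 <= P} -> {subset positions e.2 <= P} ->
  2 ^ (height + 2) <= T ->
  (forall c, c \in explore p T [:: config0] -> c.1.1 = v -> holds (val c.2) e) ->
  forall stk st, sexec p v stk st -> holds (val st) e.
Proof.
move=> /andP[we1 we2] P1 P2 leT H stk st sx; apply: NNPP => ne.
have [w1 [w2 [/stack_ok_derivable d1 d2 Est]]] := sexec_derivable sx.
have [k lek Hk] := derivable_cl.
have [F sF [F0 FQ]] : detects n S P (fun st => holds (val st) e) st.
  by apply: detects_eq => //; apply: wf_term_vars; eassumption.
have [l Hl] := spanned_Phi sF.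
(* The column [l] times the row of the initial store is a rank-one matrix, which turns the detecting
   function into a trace functional to which [cl] applies. *)
have trE w : all (wf_op n S) w ->
    (\tr ((l *m Phi n S P store0) *m mxw (op_mx n S P) w))%R = F (run store0 w).
  move=> ww; rewrite Hl run_mxP // -mulmxA mxtrace_mulC.
  by rewrite /mxtrace big_ord1.
have wd X w : derivable X w -> all (wf_op n S) w.
  by move=> [k' /derives_wf /andP[]].
have cl12 := @cl_cat _ _ (op_mx n S P) _ _ (fun w => exists w1 w2,
  [/\ derives two_atoms k (true, (v.1, 0)) w1, derives two_atoms k (false, v) w2 & w = w1 ++ w2])
  _ _ _ (Hk _ _ d1) (Hk _ _ d2).
apply: F0; rewrite Est -trE; last by rewrite all_cat (wd _ _ d1) (wd _ _ d2).
apply: cl12 => [y z Dy Dz|_ [y [z [Dy Dz ->]]]]; first by exists y, z.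
have /andP[wy _] := derives_wf Dy; have /andP[wz _] := derives_wf Dz.
rewrite trE ?all_cat ?wy // FQ //.
have [stk' Hy] := derives_explore Dy.
have Hz := derives_explore_same Dz stk' (run store0 y).
apply: (H (v, stk', run store0 (y ++ z))) => //; rewrite run_cat.
(* Entering the procedure and the same-level path take [2 ^ (k + 1) - 2] rounds each. *)
apply: (explore_le _ (explore_trans Hy Hz)); apply: leq_trans leT.
have := run_lengthE k; have : 2 ^ k.+2 <= 2 ^ (height + 2) by rewrite leq_exp2l // addn2 !ltnS.
rewrite [2 ^ k.+2]expnS; set a := 2 ^ _; set b := 2 ^ _; lia.
Qed.
End Bound.
End Derivations.

(** * The programs *)

(* A function receives its arguments as one tree [enc_seq args], and records are
   encoded in the same way; [item k e] is the [k]-th component of [e]. *)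
Definition item k e : expr := ELeft (iter k ERight e).
Definition arg k := item k Arg.
Definition call f es := ECall f (foldr ENode ELeaf es).
Definition elist es : expr := foldr ENode ELeaf es.
Notation etrue := (ENode ELeaf ELeaf).
Notation esucc e := (ENode ELeaf e).
Notation evar e := (elist [:: ELeaf; e]).
Notation epair e1 e2 := (ENode e1 e2).

Fixpoint quote (t : tree) : expr :=
  if t is Node l r then ENode (quote l) (quote r) else ELeaf.

(** Places of the bodies in [library]; place 0 belongs to the entry point, the function run by
    [computes]. *)
Definition f_eq := 1. Definition f_app := 2. Definition f_mul := 3.
Definition f_size := 4. Definition f_exp := 5. Definition f_nth := 6.
Definition f_set := 7. Definition f_subst := 8. Definition f_substs := 9.
Definition f_edge := 10. Definition f_edges := 11. Definition f_succ := 12.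
Definition f_succs := 13. Definition f_explore := 14. Definition f_init := 15.
Definition f_check := 16. Definition f_bound := 17. Definition f_config0 := 18.
Definition f_decide := 19. Definition f_find := 20. Definition f_vars := 21.
Definition f_cand := 22. Definition f_cands := 23. Definition f_apps := 24.
Definition f_cart := 25. Definition f_conses := 26. Definition f_filter := 27.
Definition f_eqs := 28. Definition f_infer := 29.

Definition b_eq :=
  EIf (arg 0)
    (EIf (arg 1)
       (EIf (call f_eq [:: ELeft (arg 0); ELeft (arg 1)])
          (call f_eq [:: ERight (arg 0); ERight (arg 1)]) ELeaf)
       ELeaf)
    (EIf (arg 1) ELeaf etrue).
(** On unary numerals, which are lists of leaves, appending is addition. *)
Definition b_app :=
  EIf (arg 0) (ENode (ELeft (arg 0)) (call f_app [:: ERight (arg 0); arg 1])) (arg 1).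
Definition b_mul :=
  EIf (arg 0) (call f_app [:: arg 1; call f_mul [:: ERight (arg 0); arg 1]]) ELeaf.
Definition b_size :=
  EIf (arg 0)
    (esucc (call f_app [:: call f_size [:: ELeft (arg 0)]; call f_size [:: ERight (arg 0)]]))
    (esucc ELeaf).
Definition b_exp :=
  EIf (arg 0)
    (call f_mul [:: esucc (esucc ELeaf); call f_exp [:: ERight (arg 0)]])
    (esucc ELeaf).
Definition b_nth :=
  EIf (arg 1) (call f_nth [:: ERight (arg 0); ERight (arg 1)]) (ELeft (arg 0)).
Definition b_set :=
  EIf (arg 1)
    (ENode (ELeft (arg 0)) (call f_set [:: ERight (arg 0); ERight (arg 1); arg 2]))
    (ENode (arg 2) (ERight (arg 0))).
Definition b_subst :=
  EIf (item 0 (arg 1))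
    (elist [:: item 0 (arg 1); item 1 (arg 1); call f_substs [:: arg 0; item 2 (arg 1)]])
    (call f_nth [:: arg 0; item 1 (arg 1)]).
Definition b_substs :=
  EIf (arg 1)
    (ENode (call f_subst [:: arg 0; ELeft (arg 1)]) (call f_substs [:: arg 0; ERight (arg 1)]))
    ELeaf.
Notation eproc p q := (call f_nth [:: item 2 p; q]).
Notation econfig q v stk st := (elist [:: q; v; stk; st]).
(* The tests distinguish the tags 2 (call), 1 (havoc) and 0 (assignment). *)
Definition b_edge :=
  let lab := item 1 (arg 2) in
  let cfg st := econfig (item 0 (arg 1)) (item 2 (arg 2)) (item 2 (arg 1)) st in
  let store t := call f_set [:: item 3 (arg 1); item 1 lab; t] in
  EIf (call f_eq [:: item 0 (arg 2); item 1 (arg 1)])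
    (EIf (item 0 lab)
       (EIf (ERight (item 0 lab))
          (elist [:: econfig (item 1 lab) (item 1 (eproc (arg 0) (item 1 lab)))
             (ENode (epair (item 0 (arg 1)) (item 2 (arg 2))) (item 2 (arg 1)))
             (item 3 (arg 1))])
          (elist [:: cfg (store (evar ELeaf)); cfg (store (evar (esucc ELeaf)))]))
       (elist [:: cfg (store (call f_subst [:: item 3 (arg 1); item 2 lab]))]))
    ELeaf.
Definition b_edges :=
  EIf (arg 2)
    (call f_app [:: call f_edge [:: arg 0; arg 1; ELeft (arg 2)];
                    call f_edges [:: arg 0; arg 1; ERight (arg 2)]])
    ELeaf.
Definition b_succ :=
  let proc := eproc (arg 0) (item 0 (arg 1)) in
  let stk := item 2 (arg 1) in
  call f_app [:: call f_edges [:: arg 0; arg 1; item 3 proc];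
    EIf (call f_eq [:: item 1 (arg 1); item 2 proc])
      (EIf stk
         (elist [:: econfig (ELeft (ELeft stk)) (ERight (ELeft stk)) (ERight stk)
            (item 3 (arg 1))])
         ELeaf)
      ELeaf].
Definition b_succs :=
  EIf (arg 1)
    (call f_app [:: call f_succ [:: arg 0; ELeft (arg 1)];
                    call f_succs [:: arg 0; ERight (arg 1)]])
    ELeaf.
Definition b_explore :=
  EIf (arg 1)
    (call f_app [:: call f_explore [:: arg 0; ERight (arg 1); arg 2];
       call f_succs [:: arg 0; call f_explore [:: arg 0; ERight (arg 1); arg 2]]])
    (arg 2).
Definition b_init :=
  EIf (arg 0) (call f_init [:: ERight (arg 0); ENode (evar (ERight (arg 0))) (arg 1)]) (arg 1).
Definition b_check :=
  let c := ELeft (arg 2) in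
  let rest := call f_check [:: arg 0; arg 1; ERight (arg 2)] in
  EIf (arg 2)
    (EIf (call f_eq [:: epair (item 0 c) (item 1 c); arg 0])
       (EIf (call f_eq [:: call f_subst [:: item 3 c; ELeft (arg 1)];
                           call f_subst [:: item 3 c; ERight (arg 1)]])
          rest ELeaf)
       rest)
    etrue.
Definition b_bound :=
  let sq e := call f_mul [:: e; e] in
  let s := call f_size [:: arg 0] in
  call f_exp [:: sq (sq (sq (call f_app [:: s; s])))].
Definition b_config0 :=
  econfig (item 1 (arg 0)) (item 1 (eproc (arg 0) (item 1 (arg 0)))) ELeaf
    (call f_init [:: item 0 (arg 0); ELeaf]).
Notation eexplore p v e :=
  (call f_explore [:: p; call f_bound [:: elist [:: p; v; e]]; elist [:: call f_config0 [:: p]]]).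
Definition b_decide :=
  call f_check [:: arg 1; arg 2; eexplore (arg 0) (arg 1) (arg 2)].
Definition b_find :=
  let c := ELeft (arg 1) in
  EIf (arg 1)
    (EIf (call f_eq [:: epair (item 0 c) (item 1 c); arg 0])
       (elist [:: item 3 c]) (call f_find [:: arg 0; ERight (arg 1)]))
    ELeaf.
Definition b_vars :=
  let rest := call f_vars [:: arg 0; ERight (arg 1); esucc (arg 2)] in
  EIf (arg 1)
    (EIf (call f_eq [:: ELeft (arg 1); arg 0]) (ENode (evar (arg 2)) rest) rest)
    ELeaf.
Definition b_cand :=
  call f_app [:: call f_vars [:: arg 1; arg 0; ELeaf];
    EIf (item 0 (arg 1))
      (call f_apps [:: item 1 (arg 1); call f_cands [:: arg 0; item 2 (arg 1)]])
      ELeaf].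
Definition b_cands :=
  EIf (arg 1)
    (call f_cart [:: call f_cand [:: arg 0; ELeft (arg 1)];
                     call f_cands [:: arg 0; ERight (arg 1)]])
    (elist [:: ELeaf]).
Definition b_apps :=
  EIf (arg 1)
    (ENode (elist [:: esucc ELeaf; arg 0; ELeft (arg 1)])
       (call f_apps [:: arg 0; ERight (arg 1)]))
    ELeaf.
Definition b_cart :=
  EIf (arg 0)
    (call f_app [:: call f_conses [:: ELeft (arg 0); arg 1];
                    call f_cart [:: ERight (arg 0); arg 1]])
    ELeaf.
Definition b_conses :=
  EIf (arg 1)
    (ENode (ENode (arg 0) (ELeft (arg 1))) (call f_conses [:: arg 0; ERight (arg 1)]))
    ELeaf.
Definition b_filter :=
  let e := epair (evar (arg 2)) (ELeft (arg 3)) in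
  let rest := call f_filter [:: arg 0; arg 1; arg 2; ERight (arg 3)] in
  EIf (arg 3) (EIf (call f_decide [:: arg 0; arg 1; e]) (ENode e rest) rest) ELeaf.
Definition b_eqs :=
  EIf (arg 3)
    (call f_app [::
       call f_filter [:: arg 0; arg 1; arg 4; call f_cand [:: arg 2; ELeft (arg 3)]];
       call f_eqs [:: arg 0; arg 1; arg 2; ERight (arg 3); esucc (arg 4)]])
    ELeaf.
(* [bad] encodes an equality that never holds: it is valid only at unreachable
   points. *)
Definition b_infer (bad : tree) :=
  let found := call f_find [:: arg 1; eexplore (arg 0) (arg 1) (quote bad)] in
  EIf found
    (call f_eqs [:: arg 0; arg 1; ELeft found; ELeft found; ELeaf])
    (elist [:: quote bad]).

Definition library (bad : tree) (entry : expr) : code :=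
  [:: entry; b_eq; b_app; b_mul; b_size; b_exp; b_nth; b_set; b_subst; b_substs;
      b_edge; b_edges; b_succ; b_succs; b_explore; b_init; b_check; b_bound;
      b_config0; b_decide; b_find; b_vars; b_cand; b_cands; b_apps; b_cart;
      b_conses; b_filter; b_eqs; b_infer bad].

(** * Evaluation rules *)

Section Evaluation.
Variable C : code.

Definition fn f args r := exists2 body, onth C f = Some body & eval C (enc_seq args) body r.

Lemma ev_left a e b r : eval C a e b -> left_ b = r -> eval C a (ELeft e) r.
Proof. by move=> H <-; constructor. Qed.

Lemma ev_right a e b r : eval C a e b -> right_ b = r -> eval C a (ERight e) r.
Proof. by move=> H <-; constructor. Qed.

Lemma ev_item a k e b r :
  eval C a e b -> left_ (iter k right_ b) = r -> eval C a (item k e) r.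
Proof. by move=> H <-; constructor; elim: k => //= k IH; constructor. Qed.

Lemma ev_arg args k r : nth Leaf args k = r -> eval C (enc_seq args) (arg k) r.
Proof.
move=> E; apply: ev_item (eval_arg _ _) _; rewrite -{}E.
elim: k args => [|k IH] [|b args] //; last by rewrite iterSr IH.
by have -> : iter k.+1 right_ (enc_seq [::]) = Leaf by elim: k.+1 => //= ? ->.
Qed.

Lemma ev_if a e e1 e2 b r : eval C a e b ->
  eval C a (if b is Node _ _ then e1 else e2) r -> eval C a (EIf e e1 e2) r.
Proof. by case: b => [|l r'] H H'; [apply: eval_if_leaf H H'|apply: eval_if_node H H']. Qed.

Lemma ev_elist a es bs : List.Forall2 (eval C a) es bs -> eval C a (elist es) (enc_seq bs).
Proof. by elim=> [|e b {}es {}bs H _ IH]; constructor. Qed.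

Lemma ev_call a f es args r : List.Forall2 (eval C a) es args -> fn f args r ->
  eval C a (call f es) r.
Proof. by move=> /ev_elist H [body Hb Hr]; apply: eval_call H Hb Hr. Qed.

Lemma ev_quote a t : eval C a (quote t) t.
Proof. by elim: t => [|l Hl r Hr] /=; constructor. Qed.
End Evaluation.

Section Configurations.
Variable Omega : countType.
Implicit Types (st : store Omega) (c : config Omega).
Definition enc_store st := enc_seq (map (@enc_term Omega) st).
Definition enc_config c := enc_seq
  [:: enc_nat c.1.1.1; enc_nat c.1.1.2; enc_seq (map enc_point c.1.2); enc_store c.2].
Definition enc_configs (cs : seq (config Omega)) := enc_seq (map enc_config cs).

Variable p : program Omega.

(** Holds out of range too: projections of [Leaf] are [Leaf], which encodes both 0 and the empty
    list, as in [no_proc]. *)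
Lemma proc_startE q :
  left_ (right_ (nth Leaf (map (@enc_procedure Omega) (procs p)) q)) =
  enc_nat (start (proc_of p q)).
Proof. by rewrite /proc_of; elim: (procs p) q => [|P Ps IH] [|q] //; exact: IH. Qed.

Lemma proc_returnE q :
  left_ (right_ (right_ (nth Leaf (map (@enc_procedure Omega) (procs p)) q))) =
  enc_nat (return_ (proc_of p q)).
Proof. by rewrite /proc_of; elim: (procs p) q => [|P Ps IH] [|q] //; exact: IH. Qed.

Lemma proc_edgesE q :
  left_ (right_ (right_ (right_ (nth Leaf (map (@enc_procedure Omega) (procs p)) q)))) =
  enc_seq (map (@enc_edge Omega) (edges (proc_of p q))).
Proof. by rewrite /proc_of; elim: (procs p) q => [|P Ps IH] [|q] //; exact: IH. Qed.
End Configurations.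
Hint Rewrite proc_startE proc_returnE proc_edgesE : lisp_val.

Create HintDb lisp.
Ltac ev_val :=
  cbn [nth left_ right_ iter enc_seq foldr enc_nat fst snd map
       enc_program enc_config enc_configs enc_point enc_edge enc_label enc_equality];
  autorewrite with lisp_val;
  repeat match goal with
  | |- context [foldr Node Leaf ?l] => change (foldr Node Leaf l) with (enc_seq l)
  | |- context [iter ?n (Node Leaf) Leaf] => change (iter n (Node Leaf) Leaf) with (enc_nat n)
  end;
  reflexivity.
(** A symbolic evaluator driven by the syntax: it resolves tests whose value shows a constructor,
    leaves calls to [tac], and stops at open tests, which are then decided by cases. *)
Ltac ev_with tac :=
  lazymatch goal with
  | |- eval _ _ (arg _) _ => eapply ev_arg; ev_val
  | |- eval _ _ (quote _) _ => eapply ev_quote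
  | |- eval _ _ (item _ _) _ => eapply ev_item; [ev_with tac | ev_val]
  | |- eval _ _ ELeaf _ => eapply eval_leaf
  | |- eval _ _ (ENode _ _) _ => eapply eval_node; [ev_with tac | ev_with tac]
  | |- eval _ _ (elist _) _ => eapply ev_elist; ev_with tac
  | |- eval _ _ (ELeft _) _ => eapply ev_left; [ev_with tac | ev_val]
  | |- eval _ _ (ERight _) _ => eapply ev_right; [ev_with tac | ev_val]
  | |- eval _ _ (EIf _ _ _) _ => eapply ev_if; [ev_with tac | ev_with tac]
  | |- eval _ _ (call _ _) _ => eapply ev_call; [ev_with tac | tac]
  | |- List.Forall2 _ [::] _ => eapply List.Forall2_nil
  | |- List.Forall2 _ (_ :: _) _ => eapply List.Forall2_cons; [ev_with tac | ev_with tac]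
  | |- eval _ _ (match ?b with _ => _ end) _ =>
      let b' := eval hnf in b in
      lazymatch b' with
      | Leaf => change b with b'; cbv iota; ev_with tac
      | Node _ _ => change b with b'; cbv iota; ev_with tac
      | _ => idtac
      end
  | _ => idtac
  end.
Ltac ev_match :=
  lazymatch goal with
  | |- eval _ _ (match ?b with _ => _ end) _ =>
      let b' := eval hnf in b in change b with b'; cbv iota
  end.
Ltac fn_start body := exists body; [reflexivity | rewrite /body].
Ltac fn_auto := solve [eauto 4 with lisp].
Ltac ev := ev_with fn_auto.

Fixpoint tree_eqb (a b : tree) : bool :=
  match a, b with
  | Leaf, Leaf => true
  | Node l r, Node l' r' => tree_eqb l l' && tree_eqb r r'
  | _, _ => false
  end.

Lemma tree_eqbP a b : reflect (a = b) (tree_eqb a b).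
Proof.
apply: (iffP idP) => [|<-]; last by elim: a => //= l -> r ->.
by elim: a b => [|l IHl r IHr] [|l' r'] //= /andP[/IHl-> /IHr->].
Qed.

Fixpoint tree_size (a : tree) : nat :=
  if a is Node l r then (tree_size l + tree_size r).+1 else 1.

(** * The code computes the intended functions *)

Section Library.
Variables (bad : tree) (entry : expr).
Notation C := (library bad entry).
Notation fn := (fn C).

Lemma eq_fn a b : fn f_eq [:: a; b] (enc_bool (tree_eqb a b)).
Proof.
elim: a b => [|l IHl r IHr] b; fn_start b_eq.
  by case: b => [|l' r']; ev.
case: b => [|l' r']; first by ev.
eapply ev_if; first by ev.
eapply ev_if; first by ev.
eapply ev_if; first by ev.
rewrite [tree_eqb (Node l r) _]/=.
by case: (tree_eqb l l'); cbn [enc_bool andb]; ev.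
Qed.

Lemma app_fn xs ys : fn f_app [:: enc_seq xs; enc_seq ys] (enc_seq (xs ++ ys)).
Proof. by elim: xs => [|x xs IH]; fn_start b_app; ev. Qed.
Hint Resolve app_fn : lisp.

Lemma enc_natE n : enc_nat n = enc_seq (nseq n Leaf).
Proof. by elim: n => //= n ->. Qed.

Lemma add_fn m n : fn f_app [:: enc_nat m; enc_nat n] (enc_nat (m + n)).
Proof. by rewrite !enc_natE nseqD; apply: app_fn. Qed.
Hint Resolve add_fn : lisp.

Lemma mul_fn m n : fn f_mul [:: enc_nat m; enc_nat n] (enc_nat (m * n)).
Proof. by elim: m => [|m IH]; fn_start b_mul; ev. Qed.
Hint Resolve mul_fn : lisp.

Lemma size_fn a : fn f_size [:: a] (enc_nat (tree_size a)).
Proof. by elim: a => [|l IHl r IHr]; fn_start b_size; ev. Qed.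
Hint Resolve size_fn : lisp.

Lemma exp_fn n : fn f_exp [:: enc_nat n] (enc_nat (2 ^ n)).
Proof.
have dbl m : fn f_mul [:: Node Leaf (Node Leaf Leaf); enc_nat m] (enc_nat (2 * m)).
  exact: (mul_fn 2).
by elim: n => [|n IH]; fn_start b_exp; rewrite ?expnS; ev.
Qed.
Hint Resolve exp_fn : lisp.

Lemma nth_fn l n : fn f_nth [:: enc_seq l; enc_nat n] (nth Leaf l n).
Proof.
elim: n l => [|n IH] [|x l]; fn_start b_nth; try by ev.
(* Running past the end stays at the empty list, since [right_ Leaf] is [Leaf]. *)
by have := IH [::]; rewrite !nth_nil => H; ev.
Qed.
Hint Resolve nth_fn : lisp.

Lemma set_fn l n y : n < size l ->
  fn f_set [:: enc_seq l; enc_nat n; y] (enc_seq (set_nth Leaf l n y)).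
Proof. by elim: n l => [|n IH] [|x l] // lt; fn_start b_set; ev. Qed.
Hint Resolve set_fn : lisp.

Section Simulation.
Variables (Omega : countType) (ar : Omega -> nat) (p : program Omega).
Hypothesis wf_p : wf_program ar p.
Notation V := (Var Omega).
Notation n := (nvars p).
Notation val st := (nth (V 0) st).
Implicit Types (st : store Omega) (v : point) (c : config Omega).

Lemma enc_nat_inj : injective enc_nat.
Proof. by elim=> [|m IH] [|k] //= [/IH->]. Qed.

Lemma enc_seq_inj : injective enc_seq.
Proof. by elim=> [|x xs IH] [|y ys] //= [-> /IH->]. Qed.

Lemma enc_term_inj : injective (@enc_term Omega).
Proof.
elim/term_in_ind => [x|f ts IH] [y|g ss] //= [].
  by move/(@enc_nat_inj x y)->.
move/(@enc_nat_inj (pickle f) (pickle g))/(pcan_inj pickleK)->.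
move/(@enc_seq_inj (map _ _) (map _ _)) => E; congr App.
elim: ts ss IH E => [|t ts IHts] [|s ss] //= IH [Et E].
rewrite (IH t (mem_head _ _) s Et) (IHts ss _ E) // => u uin.
by apply: IH; rewrite inE uin orbT.
Qed.

Lemma eq_nat_fn a b : fn f_eq [:: enc_nat a; enc_nat b] (enc_bool (a == b)).
Proof.
have -> : (a == b) = tree_eqb (enc_nat a) (enc_nat b).
  by apply/eqP/tree_eqbP => [->|/enc_nat_inj].
exact: eq_fn.
Qed.
Hint Resolve eq_nat_fn : lisp.

Lemma eq_term_fn (s t : term Omega) :
  fn f_eq [:: enc_term s; enc_term t] (enc_bool (s == t)).
Proof.
have -> : (s == t) = tree_eqb (enc_term s) (enc_term t).
  by apply/eqP/tree_eqbP => [->|/enc_term_inj].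
exact: eq_fn.
Qed.
Hint Resolve eq_term_fn : lisp.

Lemma eq_point_fn a b v :
  fn f_eq [:: Node (enc_nat a) (enc_nat b); enc_point v] (enc_bool ((a, b) == v)).
Proof.
have -> : ((a, b) == v) = tree_eqb (enc_point (a, b)) (enc_point v).
  apply/eqP/tree_eqbP => [->//|]; case: v => a' b' [].
  by move=> /(@enc_nat_inj a a')-> /(@enc_nat_inj b b')->.
exact: eq_fn.
Qed.
Hint Resolve eq_point_fn : lisp.

Lemma subst_fn st t : all (ltn^~ (size st)) (occurrences t) ->
  fn f_subst [:: enc_seq (map (@enc_term Omega) st); enc_term t]
     (enc_term (subst (val st) t)).
Proof.
elim/term_in_ind: t => [x|f ts IH].
  rewrite /= andbT => lt; rewrite -(nth_map _ Leaf) //; fn_start b_subst; ev.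
move=> vs.
have H : fn f_substs [:: enc_seq (map (@enc_term Omega) st); enc_seq (map (@enc_term Omega) ts)]
    (enc_seq (map (@enc_term Omega) (map (subst (val st)) ts))).
  elim: ts IH vs => [|t ts IHts] IH /=; first by fn_start b_substs; ev.
  rewrite all_cat => /andP[vt vts]; have Ht := IH t (mem_head _ _) vt.
  have Hts := IHts (fun u uin => IH u (@mem_behead _ (t :: ts) u uin)) vts.
  by fn_start b_substs; ev.
by fn_start b_subst; ev.
Qed.


Lemma map_set_nth st x t : x < size st ->
  map (@enc_term Omega) (set_nth (V 0) st x t) =
  set_nth Leaf (map (@enc_term Omega) st) x (enc_term t).
Proof. by elim: st x => [|s st IH] [|x] //= lt; rewrite IH. Qed.

Lemma set_store_fn st x t : x < size st ->
  fn f_set [:: enc_store st; enc_nat x; enc_term t]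
     (enc_store (set_nth (V 0) st x t)).
Proof.
by move=> lt; rewrite /enc_store map_set_nth //; apply: set_fn; rewrite size_map.
Qed.

Lemma atom_fn st x a : x < size st ->
  fn f_set [:: enc_store st; enc_nat x; Node Leaf (Node (enc_nat a) Leaf)]
     (enc_store (set_nth (V 0) st x (V a))).
Proof. exact: (@set_store_fn st x (V a)). Qed.

Definition wf_edge (e : nat * label Omega * nat) := wf_label ar n (size (procs p)) e.1.2.

Lemma wf_edges q : all wf_edge (edges (proc_of p q)).
Proof.
case: (ltnP q (size (procs p))) => [lt|le]; last first.
  by rewrite /proc_of nth_default.
have /and3P[_ _] := wf_proc wf_p (onth_lt lt).
by apply: sub_all => e /and3P[].
Qed.

Lemma edge_fn c e : wf_edge e -> size c.2 = n ->
  fn f_edge [:: enc_program p; enc_config c; enc_edge e]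
     (enc_configs (succ_edge p c e)).
Proof.
case: c => [[[q a] stk] st]; case: e => [[a' l] b] wfe /= sz.
fn_start b_edge; eapply ev_if; first by ev.
cbv beta iota delta [succ_edge fst snd]; case: (a' == a); last by ev.
cbv beta iota delta [enc_bool].
case: l wfe => [x t|x|r].
- move=> wfe; have /andP[ltx wt] : (x < n) && wf_term ar n t := wfe.
  have H1 : fn f_subst [:: enc_store st; enc_term t] (enc_term (subst (val st) t)).
    by apply: subst_fn; rewrite sz; apply: wf_term_vars wt.
  have H2 := @set_store_fn st x (subst (val st) t); rewrite sz in H2.
  move: (H2 ltx) => {}H2; ev.
- move=> wfe; have ltx : x < n := wfe.
  have H a0 := @atom_fn st x a0; rewrite sz in H.
  have H0 := H 0 ltx; have H1 := H 1 ltx; ev.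
by move=> _; ev.
Qed.

Lemma edges_fn c es : all wf_edge es -> size c.2 = n ->
  fn f_edges [:: enc_program p; enc_config c; enc_seq (map (@enc_edge Omega) es)]
     (enc_configs (flatten (map (succ_edge p c) es))).
Proof.
move=> + sz; elim: es => [|e es IH] wfs; first by fn_start b_edges; ev.
have /andP[we wes] : wf_edge e && all wf_edge es := wfs.
have H := edge_fn we sz; have Hs := IH wes.
by rewrite /enc_configs /= map_cat; fn_start b_edges; ev.
Qed.

Lemma succ_fn c : size c.2 = n ->
  fn f_succ [:: enc_program p; enc_config c] (enc_configs (succ p c)).
Proof.
move=> sz; have H := edges_fn (wf_edges c.1.1.1) sz.
rewrite /succ /enc_configs map_cat; fn_start b_succ.
apply: (ev_call (args := [:: enc_configs (flatten (map (succ_edge p c) (edges (proc_of p c.1.1.1))));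
  enc_configs (succ_return p c)])); last exact: app_fn.
case: c sz H => [[[q a] stk] st] sz H.
apply: List.Forall2_cons; first by ev.
apply: List.Forall2_cons; last by constructor.
eapply ev_if; first by ev.
cbv beta iota delta [succ_return fst snd]; case: (a == _); last by ev.
cbv beta iota delta [enc_bool]; case: stk {sz} H => [|[r b] stk] H; ev.
Qed.

Definition sized (cs : seq (config Omega)) := all (fun c : config Omega => size c.2 == n) cs.

Lemma succs_fn cs : sized cs -> fn f_succs [:: enc_program p; enc_configs cs]
  (enc_configs (flatten (map (succ p) cs))).
Proof.
elim: cs => [|c cs IH] szs; first by fn_start b_succs; ev.
have /andP[/eqP sz szs'] : (size c.2 == n) && sized cs := szs.
have H := succ_fn sz; have Hs := IH szs'.
by rewrite /enc_configs /= map_cat; fn_start b_succs; ev.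
Qed.

Lemma sized_set st x t : size st = n -> x < n -> size (set_nth (V 0) st x t) = n.
Proof. by move=> sz lt; rewrite size_set_nth sz; apply/maxn_idPr. Qed.

Lemma sized_succ c : size c.2 = n -> sized (succ p c).
Proof.
case: c => [[u stk] st] /= sz; apply/allP => c; rewrite mem_cat => /orP[|].
  case/In_flatten_map => [[[a l] b] ein].
  have := all_In (wf_edges u.1) ein; rewrite /wf_edge /=; case: eqP => // _.
  case: l {ein} => [x t|x|q] /= wl; rewrite !inE.
  - by move=> /eqP-> /=; rewrite sized_set //; case/andP: wl.
  - by case/orP=> /eqP-> /=; rewrite sized_set.
  by move=> /eqP-> /=; apply/eqP.
rewrite /=; case: eqP => // _; case: stk => // r stk; rewrite inE => /eqP-> /=.
exact/eqP.
Qed.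

Lemma sized_explore k cs : sized cs -> sized (explore p k cs).
Proof.
move=> szs; elim: k => //= k IH; rewrite /extend /sized all_cat.
apply/andP; split=> //; apply/allP => c /flattenP[l /mapP[c' c'in ->]].
by apply: (allP (sized_succ _)); apply/eqP; apply: (allP IH).
Qed.

Lemma explore_fn k cs : sized cs ->
  fn f_explore [:: enc_program p; enc_nat k; enc_configs cs] (enc_configs (explore p k cs)).
Proof.
move=> szs; elim: k => [|k IH]; first by fn_start b_explore; ev.
have H := succs_fn (sized_explore k szs).
rewrite [explore _ _ _]/= /extend {2}/enc_configs map_cat; fn_start b_explore.
by eapply ev_if; [ev | ev].
Qed.

Lemma init_fn k m : fn f_init [:: enc_nat k; enc_seq (map (@enc_term Omega) (map V (iota k m)))]
  (enc_seq (map (@enc_term Omega) (map V (iota 0 (k + m))))).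
Proof.
elim: k m => [|k IH] m; first by fn_start b_init; ev.
have H := IH m.+1; rewrite -addSnnS in H.
by fn_start b_init; ev.
Qed.

Lemma config0_fn : fn f_config0 [:: enc_program p] (enc_config (config0 p)).
Proof.
have H := init_fn n 0; rewrite addn0 in H.
by fn_start b_config0; ev.
Qed.

Definition agrees st (e : equality Omega) := subst (val st) e.1 == subst (val st) e.2.

Lemma check_fn v e cs : sized cs -> wf_equality ar n e ->
  fn f_check [:: enc_point v; enc_equality e; enc_configs cs]
    (enc_bool (all (fun c : config Omega => (c.1.1 == v) ==> agrees c.2 e) cs)).
Proof.
move=> + /andP[we1 we2]; elim: cs => [|c cs IH] szs; first by fn_start b_check; ev.
have /andP[/eqP sz szs'] : (size c.2 == n) && sized cs := szs.
have Hs := IH szs'.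
have H1 : fn f_subst [:: enc_store c.2; enc_term e.1] (enc_term (subst (val c.2) e.1)).
  by apply: subst_fn; rewrite sz; apply: wf_term_vars we1.
have H2 : fn f_subst [:: enc_store c.2; enc_term e.2] (enc_term (subst (val c.2) e.2)).
  by apply: subst_fn; rewrite sz; apply: wf_term_vars we2.
fn_start b_check; eapply ev_if; first by ev.
ev_match; eapply ev_if; first by ev.
case: c {sz szs} H1 H2 => [[[q a] stk] st]; cbn [all fst snd] => H1 H2.
case: ((q, a) == v); cbv beta iota delta [enc_bool implb]; last by ev.
eapply ev_if; first by ev.
by rewrite /agrees; case: (_ == _); cbv beta iota delta [enc_bool andb]; ev.
Qed.

Definition bound (t : tree) :=
  let sq x := x * x in let s := tree_size t in 2 ^ sq (sq (sq (s + s))).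

Lemma bound_fn t : fn f_bound [:: t] (enc_nat (bound t)).
Proof. by fn_start b_bound; ev. Qed.

Definition explored v (e : tree) :=
  explore p (bound (enc_seq [:: enc_program p; enc_point v; e])) [:: config0 p].

Lemma sized_config0 : sized [:: config0 p].
Proof. by rewrite /sized /= size_map size_iota eqxx. Qed.

Definition decide v (e : equality Omega) :=
  all (fun c : config Omega => (c.1.1 == v) ==> agrees c.2 e) (explored v (enc_equality e)).

Lemma decide_fn v e : wf_equality ar n e ->
  fn f_decide [:: enc_program p; enc_point v; enc_equality e] (enc_bool (decide v e)).
Proof.
move=> we; have H1 := explore_fn (bound (enc_seq [:: enc_program p; enc_point v; enc_equality e])) sized_config0.
have H2 := check_fn v (sized_explore (bound (enc_seq [:: enc_program p; enc_point v; enc_equality e])) sized_config0) we.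
have H3 := config0_fn; have H4 := bound_fn (enc_seq [:: enc_program p; enc_point v; enc_equality e]).
by fn_start b_decide; ev.
Qed.

Fixpoint find_at v (cs : seq (config Omega)) : seq (store Omega) :=
  if cs is c :: cs' then if c.1.1 == v then [:: c.2] else find_at v cs' else [::].

Lemma find_fn v cs : fn f_find [:: enc_point v; enc_configs cs]
  (enc_seq (map (@enc_store Omega) (find_at v cs))).
Proof.
elim: cs => [|c cs IH]; first by fn_start b_find; ev.
case: c => [[[q a] stk] st]; fn_start b_find.
eapply ev_if; first by ev.
ev_match; eapply ev_if; first by ev.
by cbn [find_at fst snd]; case: ((q, a) == v); cbv beta iota delta [enc_bool]; ev.
Qed.

Fixpoint vars_at u st y : seq (term Omega) :=
  if st is s :: st' then
    if s == u then V y :: vars_at u st' y.+1 else vars_at u st' y.+1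
  else [::].

Lemma vars_fn u st y : fn f_vars [:: enc_term u; enc_store st; enc_nat y]
  (enc_store (vars_at u st y)).
Proof.
elim: st y => [|s st IH] y; first by fn_start b_vars; ev.
have H : fn f_vars [:: enc_term u; enc_store st; Node Leaf (enc_nat y)]
  (enc_store (vars_at u st y.+1)) := IH y.+1.
fn_start b_vars; eapply ev_if; first by ev.
ev_match; eapply ev_if; first by ev.
by cbn [vars_at]; case: (s == u); cbv beta iota delta [enc_bool]; ev.
Qed.

Definition cart (ts : seq (term Omega)) (tss : seq (seq (term Omega))) :=
  flatten [seq map (cons t) tss | t <- ts].

(* The terms over the program variables whose value in [st] is [u]. *)
Fixpoint cand st u : seq (term Omega) :=
  vars_at u st 0 ++
  (if u is App f us then map (App f) (foldr cart [:: [::]] (map (cand st) us)) else [::]).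

Lemma conses_fn t tss : fn f_conses [:: enc_term t; enc_seq (map (@enc_store Omega) tss)]
  (enc_seq (map (@enc_store Omega) (map (cons t) tss))).
Proof. by elim: tss => [|ts tss IH]; fn_start b_conses; ev. Qed.

Lemma cart_fn ts tss : fn f_cart [:: enc_store ts; enc_seq (map (@enc_store Omega) tss)]
  (enc_seq (map (@enc_store Omega) (cart ts tss))).
Proof.
elim: ts => [|t ts IH]; first by fn_start b_cart; ev.
have H := conses_fn t tss.
by rewrite /cart /= map_cat; fn_start b_cart; ev.
Qed.

Lemma apps_fn f tss : fn f_apps [:: enc_nat (pickle f); enc_seq (map (@enc_store Omega) tss)]
  (enc_store (map (App f) tss)).
Proof. by elim: tss => [|ts tss IH]; fn_start b_apps; ev. Qed.

Lemma cand_fn st u : fn f_cand [:: enc_store st; enc_term u] (enc_store (cand st u)).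
Proof.
elim/term_in_ind: u => [x|f us IH].
  have H := vars_fn (V x) st 0.
  have Ha := app_fn (map (@enc_term Omega) (vars_at (V x) st 0)) [::].
  by rewrite [cand _ _]/= cats0; rewrite cats0 in Ha; fn_start b_cand; ev.
have H := vars_fn (App f us) st 0.
have Hs : fn f_cands [:: enc_store st; enc_store us]
    (enc_seq (map (@enc_store Omega) (foldr cart [:: [::]] (map (cand st) us)))).
  elim: us IH {H} => [|u us IHus] IH; first by fn_start b_cands; ev.
  have Hu := IH u (mem_head _ _).
  have Hus := IHus (fun t tin => IH t (@mem_behead _ (u :: us) t tin)).
  have Hc := cart_fn (cand st u) (foldr cart [:: [::]] (map (cand st) us)).
  by fn_start b_cands; ev.
have Ha := apps_fn f (foldr cart [:: [::]] (map (cand st) us)).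
by rewrite [cand _ _]/= {2}/enc_store map_cat; fn_start b_cand; ev.
Qed.

Definition filter_eqs v x ts : seq (equality Omega) :=
  [seq e <- [seq (V x, t) | t <- ts] | decide v e].

Lemma filter_fn v x ts : x < n -> all (wf_term ar n) ts ->
  fn f_filter [:: enc_program p; enc_point v; enc_nat x; enc_store ts]
     (enc_equalities (filter_eqs v x ts)).
Proof.
move=> ltx; elim: ts => [|t ts IH] wts; first by fn_start b_filter; ev.
have /andP[wt wts'] : wf_term ar n t && all (wf_term ar n) ts := wts.
have Hs := IH wts'.
have we : wf_equality ar n (V x, t) by rewrite /wf_equality /= ltx.
have H : fn f_decide [:: enc_program p; enc_point v; Node (enc_term (V x)) (enc_term t)]
    (enc_bool (decide v (V x, t))) := decide_fn v we.
fn_start b_filter; eapply ev_if; first by ev.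
ev_match; eapply ev_if; first by ev.
rewrite /filter_eqs [filter _ _]/=.
by case: (decide v (V x, t)); cbv beta iota delta [enc_bool]; ev.
Qed.

(** [us] is the part of [st] still to be scanned and [x] the index of its first cell. *)
Fixpoint equalities_at v st us x : seq (equality Omega) :=
  if us is u :: us' then filter_eqs v x (cand st u) ++ equalities_at v st us' x.+1
  else [::].

Lemma eqs_fn v st us x : x + size us <= n ->
  (forall u, u \in us -> all (wf_term ar n) (cand st u)) ->
  fn f_eqs [:: enc_program p; enc_point v; enc_store st; enc_store us; enc_nat x]
     (enc_equalities (equalities_at v st us x)).
Proof.
elim: us x => [|u us IH] x /= le wc; first by fn_start b_eqs; ev.
have Hs : fn f_eqs [:: enc_program p; enc_point v; enc_store st; enc_store us;
    Node Leaf (enc_nat x)] (enc_equalities (equalities_at v st us x.+1)).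
  by apply: (IH x.+1) => [|t tin]; [rewrite addSnnS | apply: wc; rewrite inE tin orbT].
have Hf : fn f_filter [:: enc_program p; enc_point v; enc_nat x; enc_store (cand st u)]
     (enc_equalities (filter_eqs v x (cand st u))).
  by apply: filter_fn; [apply: leq_trans le; rewrite addnS ltnS leq_addr | apply: wc; rewrite mem_head].
have Hc := cand_fn st u.
by rewrite /enc_equalities map_cat; fn_start b_eqs; ev.
Qed.
End Simulation.
End Library.

(** * Bounds and correctness *)

Section Sizes.
Variable Omega : countType.

Lemma tree_size_gt0 a : 0 < tree_size a. Proof. by case: a. Qed.

Lemma tree_size_nat k : tree_size (enc_nat k) = k.*2.+1.
Proof. by elim: k => //= k ->; lia. Qed.

Lemma tree_size_seq l : tree_size (enc_seq l) = (sumn (map tree_size l) + size l).+1.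
Proof. by elim: l => //= x l ->; lia. Qed.

Lemma weight_le (T U : Type) (enc : T -> tree) (f : T -> seq U) (g : U -> nat) l :
  (forall x, sumn (map g (f x)) <= tree_size (enc x)) ->
  sumn (map g (flatten (map f l))) <= tree_size (enc_seq (map enc l)).
Proof.
move=> H; rewrite tree_size_seq; elim: l => //= x l IH.
by rewrite map_cat sumn_cat; have := H x; lia.
Qed.

Lemma term_size_enc (t : term Omega) : term_size t <= tree_size (enc_term t).
Proof.
elim/term_in_ind: t => [x|f ts IH]; first by rewrite /= ltn0Sn.
have : sumn (map (@term_size Omega) ts) <= sumn (map tree_size (map (@enc_term Omega) ts)).
  elim: ts IH => //= t ts IHts IH; rewrite leq_add ?IH ?mem_head //.
  by apply: IHts => u uin; apply: IH; rewrite inE uin orbT.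
have -> : tree_size (enc_term (App f ts)) = (tree_size (enc_nat 1) + (tree_size (enc_nat (pickle f)) +
   (tree_size (enc_seq (map (@enc_term Omega) ts)) + 1).+1).+1).+1 by [].
by rewrite [tree_size (enc_seq _)]tree_size_seq /=; lia.
Qed.

Definition label_terms (l : label Omega) := if l is Assign _ t then [:: t] else [::].
Definition edge_terms (e : nat * label Omega * nat) := label_terms e.1.2.
Definition proc_terms (P : procedure Omega) := flatten (map edge_terms (edges P)).
Definition rhs_terms (p : program Omega) := flatten (map proc_terms (procs p)).

Lemma rhs_terms_size p :
  sumn (map (@term_size Omega) (rhs_terms p)) <= tree_size (enc_program p).
Proof.
apply: (@leq_trans (tree_size (enc_seq (map (@enc_procedure Omega) (procs p))))).
  apply: weight_le => P.
  apply: (@leq_trans (tree_size (enc_seq (map (@enc_edge Omega) (edges P))))).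
    apply: weight_le => -[[a l] b]; rewrite /edge_terms /label_terms /=.
    by case: l => //= x t; have := term_size_enc t; lia.
  by rewrite /enc_procedure /=; lia.
by rewrite /enc_program /=; lia.
Qed.

Definition rhs_small (p : program Omega) :=
  [seq s <- flatten (map (@subterms Omega) (rhs_terms p)) | ~~ hole s].

Lemma size_rhs_small p : size (rhs_small p) <= tree_size (enc_program p).
Proof.
rewrite size_filter; apply: leq_trans (count_size _ _) _.
rewrite size_flatten /shape -map_comp (eq_map (@size_subterms Omega)).
exact: rhs_terms_size.
Qed.

Lemma procs_size (p : program Omega) : size (procs p) <= tree_size (enc_program p).
Proof.
apply: (@leq_trans (tree_size (enc_seq (map (@enc_procedure Omega) (procs p))))).
  by rewrite tree_size_seq size_map; lia.
by rewrite /enc_program /=; lia.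
Qed.

Lemma npoints_size (p : program Omega) q P :
  onth (procs p) q = Some P -> npoints P <= tree_size (enc_program p).
Proof.
move=> E; apply: (@leq_trans (tree_size (enc_seq (map (@enc_procedure Omega) (procs p))))).
  rewrite tree_size_seq.
  suff: npoints P <= sumn (map tree_size (map (@enc_procedure Omega) (procs p))) by lia.
  elim: (procs p) q E => [|Q Ps IH] [|q] //= => [[->]|/IH]; last by lia.
  have := tree_size_nat (npoints P); lia.
by rewrite /enc_program /=; lia.
Qed.

Lemma nvars_size (p : program Omega) : nvars p < tree_size (enc_program p).
Proof. by rewrite /enc_program /= tree_size_nat; lia. Qed.

Lemma size_positions (t : term Omega) : size (positions t) = term_size t.
Proof.
elim/term_in_ind: t => [x|f ts IH] //=.
rewrite size_allpairs_dep; congr (sumn _).+1.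
apply: (@eq_from_nth _ 0); rewrite !size_map ?size_iota // => i lt.
rewrite (nth_map 0) ?size_iota // nth_iota // !(nth_map (Var Omega 0)) //.
exact/IH/mem_nth.
Qed.

Lemma position_size (t : term Omega) l : l \in positions t -> size l < term_size t.
Proof.
elim/term_in_ind: t l => [x|f ts IH] l; first by rewrite inE => /eqP->.
rewrite inE => /orP[/eqP-> //|/allpairsPdep[i [q [+ qin ->]]]].
rewrite mem_iota /= add0n => lt.
rewrite (nth_map (Var Omega 0)) // in qin.
have tin := mem_nth (Var Omega 0) lt.
by have := IH _ tin _ qin; have := term_size_arg f tin; rewrite /=; lia.
Qed.

(** Closes the set of positions under removing the first index, as [P_behead] demands. *)
Definition suffixes (l : seq nat) := [seq drop i l | i <- iota 0 (size l).+1].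
Definition eq_positions (e : equality Omega) :=
  flatten (map suffixes (positions e.1 ++ positions e.2)).

Lemma mem_suffixes l k : drop k l \in suffixes l.
Proof.
case: (leqP k (size l)) => le.
  by apply/mapP; exists k; rewrite ?mem_iota.
apply/mapP; exists (size l); first by rewrite mem_iota /= add0n ltnSn.
by rewrite drop_size drop_oversize // ltnW.
Qed.

Lemma eq_positions_behead e i l : i :: l \in eq_positions e -> l \in eq_positions e.
Proof.
case/flattenP => m /mapP[q qin ->] /mapP[k _ E]; apply/flattenP.
exists (suffixes q); first exact: map_f.
have -> : l = drop k.+1 q by rewrite -add1n -drop_drop -E /= drop0.
exact: mem_suffixes.
Qed.

Lemma eq_positions_sub e q : q \in positions e.1 ++ positions e.2 -> q \in eq_positions e.
Proof.
move=> qin; apply/flattenP; exists (suffixes q); first exact: map_f.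
by rewrite -[X in X \in _]drop0 mem_suffixes.
Qed.

Lemma size_eq_positions e :
  size (eq_positions e) <= tree_size (enc_equality e) * tree_size (enc_equality e).
Proof.
set s := tree_size _.
have [le1 le2] : term_size e.1 <= s /\ term_size e.1 + term_size e.2 <= s.
  have := term_size_enc e.1; have := term_size_enc e.2; rewrite /s /=; lia.
have le3 : term_size e.2 <= s by lia.
rewrite size_flatten /shape -map_comp.
have H (L : seq (seq nat)) : (forall l, l \in L -> size l < s) ->
    sumn (map (size \o suffixes) L) <= size L * s.
  elim: L => //= l L IH HL; rewrite mulSn leq_add //.
    by rewrite /suffixes size_map size_iota HL ?mem_head.
  by apply: IH => m mL; apply: HL; rewrite inE mL orbT.
apply: leq_trans (H _ _) _ => [l|].
  rewrite mem_cat => /orP[] /position_size; lia.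
by rewrite size_cat !size_positions leq_mul2r le2 orbT.
Qed.

(** The dimension is at most [s * (4 * s ^ 2)], so [h] is at most [32 * s ^ 8]. The eighth power of
    [2 * s], three squarings, equals [256 * s ^ 8] and leaves room for the summand 2. *)
Lemma bound_enough s n a b h : 0 < s -> n.+1 <= s -> a <= s -> b <= s * s ->
  h = 2 * (s * s) * ((n.+1 * (1 + a + (b + b))) * (n.+1 * (1 + a + (b + b)))) ->
  let sq x := x * x in h + 2 <= sq (sq (sq (s + s))).
Proof.
move=> s0 n_s a_s b_s -> /=; set D := n.+1 * _.
pose q := s * s * s.
have q0 : 0 < q by rewrite !muln_gt0 s0.
have D4 : D <= 4 * q.
  apply: (@leq_trans (s * (4 * (s * s)))); last by rewrite /q; nia.
  apply: leq_mul => //; nia.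
have DD : D * D <= 16 * (q * q).
  by apply: leq_trans (leq_mul D4 D4) _; rewrite mulnACA.
pose m := (s * s) * (q * q).
have m0 : 0 < m by rewrite /m /q !muln_gt0 s0.
have le : 2 * (s * s) * (D * D) <= 32 * m.
  apply: leq_trans (leq_mul (leqnn _) DD) _; rewrite /m.
  by set x := s * s; set y := q * q; lia.
have -> : (s + s) * (s + s) * ((s + s) * (s + s)) *
  ((s + s) * (s + s) * ((s + s) * (s + s))) = 256 * m.
  by rewrite /m /q; lia.
by move: le; set z := 2 * _ * _; lia.
Qed.
End Sizes.

(** * Correctness of deciding and inferring *)

Section Correctness.
Variables (Omega : countType) (ar : Omega -> nat) (p : program Omega) (v : point).
Hypothesis wf_p : wf_program ar p.
Hypothesis rhs1 : rhs_at_most_one_var p.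
Variables (c d : term Omega).
Hypotheses (ground_c : ground ar c) (ground_d : ground ar d) (cd : c <> d).
Notation V := (Var Omega).
Notation n := (nvars p).
Notation val st := (nth (V 0) st).
Implicit Types (st : store Omega) (e : equality Omega).

Lemma decide_symbolic e : wf_equality ar n e ->
  reflect (forall stk st, sexec p v stk st -> holds (val st) e) (decide p v e).
Proof.
move=> we; apply: (iffP allP) => [H|H [[u stk] st] cin]; last first.
  apply/implyP => /= /eqP Eu; rewrite -Eu in H.
  by apply/eqP; apply: (H stk st); apply: (explore_sexec wf_p cin).
set s := tree_size (enc_seq [:: enc_program p; enc_point v; enc_equality e]).
have [sp se] : tree_size (enc_program p) <= s /\ tree_size (enc_equality e) <= s.
  have -> : s = (tree_size (enc_program p) + (tree_size (enc_point v) +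
    (tree_size (enc_equality e) + 1).+1).+1).+1 by [].
  by move: (tree_size _) (tree_size _) (tree_size _) => x y z; lia.
(* The size [s] of the whole input serves as bound on both procedure indices and program points. *)
apply: (@bounded_test _ _ _ wf_p (rhs_small p) (eq_positions e) s
  _ _ _ _ rhs1 _ _ _ v e (bound (enc_seq [:: enc_program p; enc_point v; enc_equality e]))) => //.
- by move=> g; rewrite mem_filter => /andP[].
- move=> g t; rewrite !mem_filter => /andP[hg /flattenP[l /mapP[r rin ->] gr]] tg.
  rewrite (subterms_nohole tg) //=; apply/flattenP.
  by exists (subterms r); [apply: map_f | apply: subterms_trans tg gr].
- by apply: eq_positions_sub; rewrite mem_cat; case: (e.1).
- exact: eq_positions_behead.
- move=> u x t w [_ [P EP ein]]; apply/allP => r rt; rewrite mem_filter.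
  case: (hole r) => //=; apply/flattenP; exists (subterms t) => //; apply: map_f.
  apply/In_flatten_map; exists P; first exact: onth_In EP.
  by apply/In_flatten_map; exists (u.2, Assign x t, w.2) => //=; rewrite inE.
- exact: leq_trans (procs_size p) sp.
- by move=> q Q /npoints_size le; apply: leq_trans le sp.
- by move=> q qin; apply: eq_positions_sub; rewrite mem_cat qin.
- by move=> q qin; apply: eq_positions_sub; rewrite mem_cat qin orbT.
- rewrite /bound leq_exp2l //.
  apply: (@bound_enough s n (size (rhs_small p)) (size (eq_positions e))).
  + exact: tree_size_gt0.
  + exact: leq_trans (nvars_size p) sp.
  + exact: leq_trans (size_rhs_small p) sp.
  + exact: leq_trans (size_eq_positions e) (leq_mul se se).
  + by rewrite dimE.
by move=> c0 c0in Ec; have := H c0 c0in; rewrite Ec eqxx => /eqP.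
Qed.

Lemma decide_valid e : wf_equality ar n e -> (decide p v e <-> valid ar p v e).
Proof.
move=> we; rewrite (valid_symbolic wf_p v ground_c ground_d cd we).
by split=> /decide_symbolic; apply.
Qed.

Lemma subst_ground_id (s : state Omega) t : ground ar t -> subst s t = t.
Proof. by move=> gt; rewrite -[RHS]subst_id; apply: subst_wf gt _. Qed.

Lemma wf_term_le k k' (t : term Omega) : k <= k' -> wf_term ar k t -> wf_term ar k' t.
Proof.
move=> le; elim/term_in_ind: t => [x|f ts IH] /=; first by move/leq_trans; apply.
by case/andP=> -> /allP wts; apply/allP => t tin; apply/IH/wts.
Qed.

Lemma sexec_wf u stk st : sexec p u stk st -> exists k, all (wf_term ar k) st.
Proof.
have setP k st' x t : size st' = n -> x < n -> all (wf_term ar k) st' ->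
    wf_term ar k t -> all (wf_term ar k) (set_nth (V 0) st' x t).
  move=> sz lt /allP wst wt; apply/(all_nthP (V 0)) => i; rewrite size_set_nth sz.
  rewrite (maxn_idPr lt) nth_set_nth /= => lti; case: eqP => // _.
  by apply/wst/mem_nth; rewrite sz.
elim=> {u stk st}.
- move=> u _ _; exists n; apply/allP => _ /mapP[x + ->]; by rewrite mem_iota.
- move=> u w stk st x t sx [k wst] ed; exists k; have /andP[lt wt] := edge_wf wf_p ed.
  have sz := sexec_size wf_p sx; apply: setP => //.
  elim/term_in_ind: t wt {ed} => [y|f ts IH] /= wt; first by apply/(allP wst)/mem_nth; rewrite sz.
  case/andP: wt => /eqP szt /allP wts; rewrite size_map szt eqxx.
  by apply/allP => _ /mapP[t tin ->]; apply: IH (wts t tin).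
- move=> u w stk st x a sx [k wst] ed; exists (maxn k a.+1); have lt := edge_wf wf_p ed.
  apply: setP => //; first exact: (sexec_size wf_p sx).
    by apply: sub_all wst => t; apply: wf_term_le; rewrite leq_maxl.
  by rewrite /= leq_maxr.
- by move=> u w r stk st q _ [k wst] _ _ _; exists k.
by move=> w r stk st _ [k wst] _; exists k.
Qed.

Lemma vars_atP u st y t : t \in vars_at u st y ->
  exists2 i, i < size st & t = V (y + i) /\ val st i = u.
Proof.
elim: st y => //= s st IH y; case: eqP => [Es|_].
  rewrite inE => /orP[/eqP->|/IH[i lt [-> E]]]; first by exists 0; rewrite ?addn0.
  by exists i.+1; rewrite ?addnS.
by move=> /IH[i lt [-> E]]; exists i.+1; rewrite ?addnS.
Qed.

Lemma mem_vars_at st y i : i < size st -> V (y + i) \in vars_at (val st i) st y.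
Proof.
elim: st y i => // s st IH y [|i] /= lt; first by rewrite eqxx addn0 mem_head.
have H : V (y + i.+1) \in vars_at (val st i) st y.+1 by rewrite addnS -addSn IH.
by case: eqP => // _; rewrite inE H orbT.
Qed.

Lemma cartP (t : term Omega) ts l L : t \in l -> ts \in L -> t :: ts \in cart l L.
Proof.
move=> tin tsin; apply/flattenP; exists (map (cons t) L); last exact: map_f.
by apply/mapP; exists t.
Qed.

(** The variables of a candidate are indices of cells, not atoms of [u], so the bound is [n]
    whatever [k] is. *)
Lemma cand_wf k st u : size st <= n -> wf_term ar k u -> all (wf_term ar n) (cand st u).
Proof.
move=> sz; elim/term_in_ind: u => [x|f us IH] wu; rewrite [cand _ _]/= all_cat.
  rewrite andbT; apply/allP => t /vars_atP[i lt [-> _]] /=; exact: leq_trans lt sz.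
apply/andP; split.
  by apply/allP => t /vars_atP[i lt [-> _]] /=; apply: leq_trans lt sz.
case/andP: wu => /eqP szu wus; apply/allP => _ /mapP[ts tsin ->] /=; rewrite -szu.
suff /andP[-> ->] : (size ts == size us) && all (wf_term ar n) ts by [].
elim: us ts IH wus tsin {szu} => [|u us IHus] ts IH /=; first by rewrite inE => _ /eqP->.
case/andP=> wu wus /flattenP[l /mapP[t tin ->] /mapP[ts' ts'in ->]] /=.
rewrite (allP (IH u (mem_head _ _) wu)) //= eqSS; apply: IHus => // s sin.
by apply: IH; rewrite inE sin orbT.
Qed.

Lemma cand_complete st t : size st = n -> wf_term ar n t ->
  t \in cand st (subst (val st) t).
Proof.
move=> sz; elim/term_in_ind: t => [x|f ts IH] wt.
  have H := @mem_vars_at st 0 x; rewrite sz in H.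
  by case E: (subst _ _) => [y|g us]; rewrite [cand _ _]/= mem_cat -E H.
rewrite [subst _ _]/= [cand _ _]/= mem_cat; apply/orP; right; apply: map_f.
case/andP: wt => _; elim: ts IH => [|t ts IHts] IH //= /andP[wt wts].
apply: cartP; first exact: IH (mem_head _ _) wt.
by apply: IHts => // s sin; apply: IH; rewrite inE sin orbT.
Qed.

Lemma mem_equalities st us x i t : i < size us -> t \in cand st (val us i) ->
  decide p v (V (x + i), t) -> (V (x + i), t) \in equalities_at p v st us x.
Proof.
elim: us x i => // u us IH x [|i] /= lt tin dec; rewrite mem_cat.
  by rewrite mem_filter dec addn0 map_f.
by apply/orP; right; rewrite addnS -addSn; apply: IH; rewrite // addSn -addnS.
Qed.

Lemma equalities_decide st us x e : e \in equalities_at p v st us x ->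
  decide p v e /\ exists i t, [/\ i < size us, t \in cand st (val us i) & e = (V (x + i), t)].
Proof.
elim: us x => //= u us IH x; rewrite mem_cat => /orP[|/IH[de [i [t [lt tin Ee]]]]].
  rewrite mem_filter => /andP[de /mapP[t tin E]]; split=> //.
  by exists 0, t; rewrite addn0.
by split=> //; exists i.+1, t; split; rewrite // Ee addnS.
Qed.

(** The search runs as long as a test of the false equality [(c, d)] would. If it misses [v], then
    [(c, d)] passes that test and [v] is unreachable. *)
Definition infer : seq (equality Omega) :=
  if find_at v (explored p v (enc_equality (c, d))) is st :: _
  then equalities_at p v st st 0 else [:: (c, d)].

Lemma find_atP (cs : seq (config Omega)) st l : find_at v cs = st :: l ->
  exists stk, (v, stk, st) \in cs.
Proof.
elim: cs => //= -[[u stk] st'] cs IH /=; case: eqP => [-> [-> _]|_ /IH[stk' H]].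
  by exists stk; rewrite mem_head.
by exists stk'; rewrite inE H orbT.
Qed.

Lemma find_at_nil (cs : seq (config Omega)) : find_at v cs = [::] -> forall c0, c0 \in cs -> c0.1.1 != v.
Proof.
elim: cs => //= -[[u stk] st'] cs IH /=; case: eqP => // /eqP ne /IH H c0.
by rewrite inE => /orP[/eqP->|/H].
Qed.

Lemma find_explored st l : find_at v (explored p v (enc_equality (c, d))) = st :: l ->
  exists stk, sexec p v stk st.
Proof. by case/find_atP => stk /(explore_sexec wf_p); exists stk. Qed.

Lemma wf_cd : wf_equality ar n (c, d).
Proof. by rewrite /wf_equality /= !ground_wf. Qed.

Lemma infer_cand_wf st l : find_at v (explored p v (enc_equality (c, d))) = st :: l ->
  size st = n /\ forall u, u \in st -> all (wf_term ar n) (cand st u).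
Proof.
move=> /find_explored[stk sx]; have sz := sexec_size wf_p sx; split=> // u uin.
have [k wst] := sexec_wf sx; apply: (@cand_wf k); first by rewrite sz.
exact: (allP wst).
Qed.

Lemma infer_wf : all (wf_equality ar n) infer.
Proof.
rewrite /infer; case E: (find_at _ _) => [|st l]; first by rewrite /= wf_cd.
have [sz wc] := infer_cand_wf E; apply/allP => e /equalities_decide[_ [i [t [lt tin ->]]]].
rewrite /wf_equality /= add0n -{1}sz lt.
exact: (allP (wc _ (mem_nth (V 0) lt)) t tin).
Qed.

(** A valid equality of applications splits into valid equalities of arguments, down to the form
    [x = t]. The value of [t] in the state [st] found at [v] is then that of [x], so [t] is among
    the candidates for [x] and survives the filter. *)
Lemma infer_correct e : wf_equality ar n e ->
  (valid ar p v e <-> entails ar n infer e).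
Proof.
move=> we; rewrite /infer; case E: (find_at _ _) => [|st l].
  have dec : decide p v (c, d).
    by apply/allP => c0 /(find_at_nil E) /negPf ->.
  split=> _.
    move=> sigma gs H; have := H (c, d) (or_introl erefl); rewrite /holds /=.
    by rewrite (subst_ground_id _ ground_c) (subst_ground_id _ ground_d) => /cd.
  have H := elimT (decide_symbolic wf_cd) dec.
  apply/decide_valid => //; apply/decide_symbolic => // stk st sx.
  have := H _ _ sx; rewrite /holds /=.
  by rewrite (subst_ground_id _ ground_c) (subst_ground_id _ ground_d) => /cd.
have [stk sx] := find_explored E; have sz := sexec_size wf_p sx.
have inE' e' : e' \in equalities_at p v st st 0 <-> List.In e' (equalities_at p v st st 0).
  elim: (equalities_at _ _ _ _ _) => //= a s IH; rewrite inE; split.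
    by case/orP=> [/eqP->|/IH]; [left|right].
  by case=> [->|/IH ->]; rewrite ?eqxx ?orbT.
split=> [ve sigma gs H|en]; last first.
  move=> stk' sigma ex; apply: en.
    exact: (exec_is_state wf_p ex).
  move=> e' /inE' e'in; have [de' [i [t [lt tin Ee]]]] := equalities_decide e'in.
  have we' : wf_equality ar n e'.
    have [_ wc] := infer_cand_wf E; rewrite Ee /wf_equality /= add0n -{1}sz lt.
    exact: (allP (wc _ (mem_nth (V 0) lt)) t tin).
  by have /(decide_valid we') := de'; apply; apply: ex.
have key x t : x < n -> wf_term ar n t -> valid ar p v (V x, t) -> sigma x = subst sigma t.
  move=> ltx wt vxt; apply: (H (V x, t)); apply/inE'.
  have wxt : wf_equality ar n (V x, t) by rewrite /wf_equality /= ltx.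
  have dxt := (decide_valid wxt).2 vxt.
  apply: (@mem_equalities st st 0 x) => //; first by rewrite sz.
  have /(_ _ _ sx) := elimT (decide_symbolic wxt) dxt; rewrite /holds /= => ->.
  exact: cand_complete.
have vs s t : wf_equality ar n (s, t) -> valid ar p v (s, t) ->
    subst (val st) s = subst (val st) t.
  by move=> wst H'; apply: (elimT (decide_symbolic wst) ((decide_valid wst).2 H') _ _ sx).
case: e we ve => s t; rewrite /wf_equality /holds /=.
elim/term_in_ind: s t => [x|f ss IH] t /andP[ws wt] ve; first exact: key.
case: t wt ve => [y|g ts] wt ve.
  by apply/esym; apply: key => // stk' sg ex; apply/esym; apply: ve ex.
(* Reachability of [v] is used here: the one state [st] already forces equal head symbols and
   equally many arguments. *)
have := vs _ _ _ ve; rewrite /wf_equality ws wt => /(_ isT) /= [Ef /(congr1 size)].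
rewrite !size_map => szs; rewrite Ef; congr App.
apply: (@eq_from_nth _ (V 0)); rewrite ?size_map // => i lt.
rewrite !(nth_map (V 0)) -?szs //.
have sin := mem_nth (V 0) lt.
have tin : nth (V 0) ts i \in ts by apply: mem_nth; rewrite -szs.
case/andP: ws => _ /allP ws; case/andP: wt => _ /allP wt.
apply: IH => //; first by apply/andP; split; [apply: ws | apply: wt].
move=> stk' sg ex; have := ve _ _ ex; rewrite /holds /= => -[_ /(congr1 (fun l => nth (V 0) l i))].
by rewrite !(nth_map (V 0)) -?szs.
Qed.

Lemma infer_fn entry :
  fn (library (enc_equality (c, d)) entry) f_infer [:: enc_program p; enc_point v]
     (enc_equalities infer).
Proof.
set bad := enc_equality (c, d).
have H1 := explore_fn bad entry wf_p (bound (enc_seq [:: enc_program p; enc_point v; bad])) (sized_config0 p).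
have H2 := find_fn bad entry v (explored p v bad).
have H3 := config0_fn bad entry p.
have H4 := bound_fn bad entry (enc_seq [:: enc_program p; enc_point v; bad]).
have found : eval (library bad entry) (enc_seq [:: enc_program p; enc_point v])
    (call f_find [:: arg 1; eexplore (arg 0) (arg 1) (quote bad)])
    (enc_seq (map (@enc_store Omega) (find_at v (explored p v bad)))) by ev.
exists (b_infer bad); [reflexivity | rewrite /b_infer].
eapply ev_if; first exact: found.
rewrite /infer -/bad; case E: (find_at _ _) found => [|st l] found; first by ev_match; ev.
have [sz wc] := infer_cand_wf E.
have le : 0 + size st <= n by rewrite add0n sz.
have H := eqs_fn bad entry wf_p v le wc.
have Hst : eval (library bad entry) (enc_seq [:: enc_program p; enc_point v])
    (ELeft (call f_find [:: arg 1; eexplore (arg 0) (arg 1) (quote bad)])) (enc_store st).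
  by eapply ev_left; [exact: found | by []].
ev_match; eapply ev_call; last exact: H.
apply: List.Forall2_cons; first by ev.
apply: List.Forall2_cons; first by ev.
apply: List.Forall2_cons; first exact: Hst.
apply: List.Forall2_cons; first exact: Hst.
by apply: List.Forall2_cons; [ev | constructor].
Qed.
End Correctness.

Lemma fn_computes bad f args r :
  fn (library bad (ECall f Arg)) f args r ->
  computes (library bad (ECall f Arg)) (enc_seq args) r.
Proof.
move=> [body Hb Hr]; eapply eval_call; [exact: eval_arg | reflexivity |].
by eapply eval_call; [exact: eval_arg | exact: Hb | exact: Hr].
Qed.

Theorem theorem9 (Omega : countType) (ar : Omega -> nat)
    (has_constant : exists c : Omega, ar c = 0) :
  exists infer decide : code,
    forall (p : program Omega) (v : point),
      wf_program ar p -> rhs_at_most_one_var p -> is_point p v ->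
      (exists E : seq (equality Omega),
         [/\ computes infer (enc_seq [:: enc_program p; enc_point v])
                      (enc_equalities E),
             all (wf_equality ar (nvars p)) E
           & forall e : equality Omega, wf_equality ar (nvars p) e ->
               (valid ar p v e <-> entails ar (nvars p) E e)])
      /\
      (forall e : equality Omega, wf_equality ar (nvars p) e ->
         exists b : bool,
           computes decide
             (enc_seq [:: enc_program p; enc_point v; enc_equality e])
             (enc_bool b)
           /\ (b <-> valid ar p v e)).
Proof.
(* The case distinction concerns the signature alone, so the two codes are fixed before the program
   is given. *)
case: (excluded_middle_informative (exists c d : term Omega,
    [/\ ground ar c, ground ar d & c <> d])) => [[c [d [gc gd cd]]]|triv].
  exists (library (enc_equality (c, d)) (ECall f_infer Arg)).
  exists (library (enc_equality (c, d)) (ECall f_decide Arg)) => p v wf_p rhs1 _; split.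
    exists (infer p v c d); split.
    - by apply: fn_computes; eapply infer_fn; eassumption.
    - exact: infer_wf.
    exact: infer_correct.
  move=> e we; exists (decide p v e); split; last exact: (@decide_valid _ ar p v wf_p rhs1 c d gc gd cd e we).
  by apply: fn_computes; eapply decide_fn; eassumption.
have eq_ground n e sigma : wf_equality ar n e -> is_state ar n sigma -> holds sigma e.
  move=> /andP[w1 w2] gs; apply: NNPP => ne; apply: triv.
  exists (subst sigma e.1), (subst sigma e.2); split=> //;
  by apply: subst_ground; [eassumption | exact: gs].
(* With at most one ground term every equality holds in every state: the empty list and the constant
   answer true are correct. *)
exists [:: ELeaf], [:: etrue] => p v wf_p _ _.
have all_valid e : wf_equality ar (nvars p) e -> valid ar p v e.
  by move=> we stk sigma ex; apply: eq_ground we (exec_is_state wf_p ex).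
split.
  exists [::]; split=> //.
    by eapply eval_call; [exact: eval_arg | reflexivity | exact: eval_leaf].
  move=> e we; split=> _; [move=> sigma gs _; exact: eq_ground we gs | exact: all_valid].
move=> e we; exists true; split; last by split=> // _; apply: all_valid.
by eapply eval_call; [exact: eval_arg | reflexivity | do !constructor].
Qed.
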